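(* Let $\boldsymbol{\lambda}$ be an $m$-multipartition of $n$ and $\mathfrak{t}$ a standard $\boldsymbol{\lambda}$-tableau. Then the primitive idempotent $E_{\mathfrak{t}}$ of the (generic) degenerate cyclotomic Hecke algebra $\mathbf{H}_{m,n}(Q)$ corresponding to $\mathfrak{t}$ is obtained by the following consecutive evaluations (first $z_1$, then $z_2$, and so on up to $z_n$): $$E_{\mathfrak{t}}=\Theta_{\boldsymbol{\lambda}}(Q)\,\Phi(z_1,\dots,z_n)\Big|_{z_1=\mathrm{res}_{\mathfrak{t}}(1)}\cdots\Big|_{z_{n-1}=\mathrm{res}_{\mathfrak{t}}(n-1)}\Big|_{z_n=\mathrm{res}_{\mathfrak{t}}(n)}.$$
   Context: Let $m,n$ be positive integers, $K$ a field and $Q=\{q_1,\dots,q_m\}\subset K$ such that $$P_{\mathbf H}(Q)=n!\prod_{1\le i<j\le m}\ \prod_{|d|\le n}(d+q_i-q_j)\neq 0\quad\text{in }K$$ ($d$ ranging over integers). This is the meaning of ''generic''; it includes the case where $q_1,\dots,q_m$ are indeterminates, after replacing the base field by a field containing them. **Algebra.** $\mathbf H=\mathbf{H}_{m,n}(Q)$ is the unital associative $K$-algebra generated by $t,t_1,\dots,t_{n-1}$ with relations: $(t-q_1)\cdots(t-q_m)=0$; $t(t_1tt_1+t_1)=(t_1tt_1+t_1)t$; $tt_i=t_it$ for $i\ge2$; $t_i^2=1$; $t_it_{i+1}t_i=t_{i+1}t_it_{i+1}$ for $1\le i<n-1$; $t_it_j=t_jt_i$ for $|i-j|>1$. The Jucys-Murphy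 elements are $J_1=t$, $J_{i+1}=t_iJ_it_i+t_i$ for $1\le i\le n-1$; they commute pairwise. **Combinatorics.** An $m$-multipartition of $n$ is an $m$-tuple $\boldsymbol\lambda=(\lambda^1;\dots;\lambda^m)$ of partitions with $\sum_c|\lambda^c|=n$; it is identified with its diagram, the set of nodes $(a,b,c)$ with $1\le c\le m$, $a\geq 1$, $1\le b\le\lambda^c_a$. A node not in $\boldsymbol\lambda$ is addable if adding it gives the diagram of an $m$-multipartition; $\mathscr A(\boldsymbol\lambda)$ is the set of addable nodes. A $\boldsymbol\lambda$-tableau is a bijection from the diagram to $\{1,\dots,n\}$; it is standard if in each component entries increase along rows and down columns. The residue of a node is $\mathrm{res}(a,b,c)=b-a+q_c$, and $\mathrm{res}_{\mathfrak t}(i)$ is the residue of the node of $\mathfrak t$ containing $i$. **Idempotents.** $E_{\mathfrak t}$ is the primitive idempotent of $\mathbf H$ projecting onto the basis vector $v_{\mathfrak t}$ of the Young (Jucys-Murphy eigenvector) basis of the Specht module $S^{\boldsymbol\lambda}$, so that $J_iE_{\mathfrak t}=E_{\mathfrak t}J_i=\mathrm{res}_{\mathfrak t}(i)E_{\mathfrak t}$ for all $i$. Explicitly, $E_\emptyset=1$ and $$E_{\mathfrak t}=E_{\mathfrak u}\prod_{\beta\in\mathscr A(\boldsymbol\mu),\,\beta\ne\alpha}\frac{J_n-\mathrm{res}(\beta)}{\mathrm{res}_{\mathfrak t}(n)-\mathrm{res}(\beta)},$$ where $\alpha$ is the node of $\mathfrak t$ containing $n$, $\mathfrak u$ is $\mathfrak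 t$ with $\alpha$ removed, $\boldsymbol\mu$ is the shape of $\mathfrak u$, and $E_{\mathfrak u}$ is the element given by the same recursion (a polynomial in $J_1,\dots,J_{n-1}$). **The coefficient.** For partitions $\lambda,\mu$ and positive integers $i,j$ put $h^{\lambda,\mu}_{i,j}=\lambda_i-i+\hat\mu_j-j+1$, where $\hat\mu$ is the conjugate partition of $\mu$. Then $$\Theta_{\boldsymbol\lambda}(Q)=\prod_{1\le s\le m}\ \prod_{(i,j)\in\lambda^s}\ \prod_{1\le t\le m}\frac{1}{h^{\lambda^s,\lambda^t}_{i,j}+q_s-q_t}$$ (here the index $t$ is an integer, not the generator). **The rational function.** Let $f(z)=(z-q_1)\cdots(z-q_m)$ and $t(z)=\frac{f(z)}{z-t}$ (in fact a polynomial in $z$ with values in $\mathbf H$), and let $t_k(x,y)=\frac1{x-y}+t_k$. Put $\phi_1(z)=t(z)$ and, for $1\le k\le n-1$, $$\phi_{k+1}(z_1,\dots,z_k;z)=t_k(z,z_k)\,\phi_k(z_1,\dots,z_{k-1};z)\,t_k.$$ We write $\phi_k(z_1,\dots,z_k)$ for $\phi_k(z_1,\dots,z_{k-1};z_k)$. Then $$\Phi(z_1,\dots,z_n)=\phi_n(z_1,\dots,z_n)\,\phi_{n-1}(z_1,\dots,z_{n-1})\cdots\phi_1(z_1).$$ *)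

(* Defs.v *)
From HB Require Import structures.
From mathcomp Require Import all_boot all_order all_algebra.
From mathcomp Require Import generic_quotient ring_quotient boolp.
From mathcomp Require monalg.
From mathcomp Require Import mpoly.

Set Implicit Arguments.
Unset Strict Implicit.
Unset Printing Implicit Defensive.

Import GRing.Theory.

Local Open Scope ring_scope.

Section Presentation.
Variables (K : fieldType) (F : algType K) (S : F -> F -> Prop).

Inductive two_sided_ideal : F -> Prop :=
| IdealRel x y of S x y : two_sided_ideal (x - y)
| Ideal0 : two_sided_ideal 0
| IdealB x y of two_sided_ideal x & two_sided_ideal y : two_sided_ideal (x - y)
| IdealMl a x of two_sided_ideal x : two_sided_ideal (a * x)
| IdealMr x a of two_sided_ideal x : two_sided_ideal (x * a).

Definition rel_ideal : {pred F} := fun x => `[< two_sided_ideal x >].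

Lemma rel_ideal_zmod : zmod_closed rel_ideal.
Proof.
split=> [|x y /asboolP Ix /asboolP Iy]; apply/asboolP; first exact: Ideal0.
exact: IdealB.
Qed.

HB.instance Definition _ := GRing.isZmodClosed.Build F rel_ideal rel_ideal_zmod.

Lemma rel_idealMl a x : x \in rel_ideal -> a * x \in rel_ideal.
Proof. by move=> /asboolP Ix; apply/asboolP/IdealMl. Qed.

Lemma rel_idealMr x a : x \in rel_ideal -> x * a \in rel_ideal.
Proof. by move=> /asboolP Ix; apply/asboolP/IdealMr. Qed.

(* The quotient of F by the relations S; the properness argument is there
   because MathComp's rings of type [nzRingType] satisfy 1 != 0. *)
Definition presented of ~ two_sided_ideal 1 := Quotient.quot rel_ideal.

Variable proper : ~ two_sided_ideal 1.
Local Notation H := (presented proper).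

HB.instance Definition _ := GRing.Zmodule.on H.

Definition presented_proj (x : F) : H := \pi_(Quotient.quot rel_ideal)%qT x.
Local Notation proj := presented_proj.

Let reprH (u : H) : F := repr (u : Quotient.quot rel_ideal).
Let reprHK u : proj (reprH u) = u. Proof. exact: reprK. Qed.

Let projP x y : reflect (proj x = proj y) (x - y \in rel_ideal).
Proof. by rewrite Quotient.idealrBE; apply: eqP. Qed.

Let projD x y : proj (x + y) = proj x + proj y.
Proof. exact: Quotient.pi_add. Qed.

Let repr_proj x : reprH (proj x) - x \in rel_ideal.
Proof. by apply/projP; rewrite reprHK. Qed.

Definition presented_one : H := proj 1.
Definition presented_mul (u v : H) : H := proj (reprH u * reprH v).
Definition presented_scale (c : K) (u : H) : H := proj (c *: reprH u).

Let projM x y : presented_mul (proj x) (proj y) = proj (x * y).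
Proof.
rewrite /presented_mul; apply/projP; set x' := reprH _; set y' := reprH _.
have -> : x' * y' - x * y = (x' - x) * y' + x * (y' - y).
  by rewrite mulrBl mulrBr addrA subrK.
by apply: rpredD; [apply: rel_idealMr | apply: rel_idealMl]; apply: repr_proj.
Qed.

Let projZ c x : presented_scale c (proj x) = proj (c *: x).
Proof.
rewrite /presented_scale; apply/projP; rewrite -scalerBr -[_ - _]mul1r scalerAl.
by apply: rel_idealMl; apply: repr_proj.
Qed.

Let mulA : associative presented_mul.
Proof.
move=> u v w; rewrite -[u]reprHK -[v]reprHK -[w]reprHK.
by rewrite !projM mulrA.
Qed.

Let mul1 : left_id presented_one presented_mul.
Proof. by move=> u; rewrite -[u]reprHK projM mul1r. Qed.

Let mulr1 : right_id presented_one presented_mul.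
Proof. by move=> u; rewrite -[u]reprHK projM mulr1. Qed.

Let mulDl : left_distributive presented_mul +%R.
Proof.
move=> u v w; rewrite -[u]reprHK -[v]reprHK -[w]reprHK.
by rewrite -projD !projM -projD mulrDl.
Qed.

Let mulDr : right_distributive presented_mul +%R.
Proof.
move=> u v w; rewrite -[u]reprHK -[v]reprHK -[w]reprHK.
by rewrite -projD !projM -projD mulrDr.
Qed.

Let one_neq0 : presented_one != 0.
Proof.
apply/eqP=> H10; apply: proper; apply/asboolP.
rewrite -[1]subr0; apply/projP; rewrite [LHS]H10.
by apply: (addrI (proj 0)); rewrite -projD !addr0.
Qed.

HB.instance Definition _ := GRing.Zmodule_isNzRing.Build H
  mulA mul1 mulr1 mulDl mulDr one_neq0.

Let scaleA a b u : presented_scale a (presented_scale b u) = presented_scale (a * b) u.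
Proof. by rewrite -[u]reprHK !projZ scalerA. Qed.

Let scale1 : left_id 1 presented_scale.
Proof. by move=> u; rewrite -[u]reprHK projZ scale1r. Qed.

Let scaleDr : right_distributive presented_scale +%R.
Proof.
move=> a u v; rewrite -[u]reprHK -[v]reprHK.
by rewrite -projD !projZ -projD scalerDr.
Qed.

Let scaleDl u : {morph presented_scale^~ u : a b / a + b}.
Proof. by move=> a b; rewrite -[u]reprHK !projZ -projD scalerDl. Qed.

HB.instance Definition _ := GRing.Zmodule_isLmodule.Build K H
  scaleA scale1 scaleDr scaleDl.

Let scaleAl (a : K) (u v : H) :
  presented_scale a (presented_mul u v) = presented_mul (presented_scale a u) v.
Proof. by rewrite -[u]reprHK -[v]reprHK !(projM, projZ) scalerAl. Qed.

HB.instance Definition _ := GRing.Lmodule_isLalgebra.Build K H scaleAl.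

Let scaleAr (a : K) (u v : H) :
  presented_scale a (presented_mul u v) = presented_mul u (presented_scale a v).
Proof. by rewrite -[u]reprHK -[v]reprHK !(projM, projZ) scalerAr. Qed.

HB.instance Definition _ := GRing.Lalgebra_isAlgebra.Build K H scaleAr.

Lemma presented_proj_zmod : zmod_morphism proj.
Proof.
move=> x y; apply: (addIr (proj y)); rewrite -projD subrK.
by rewrite addrNK.
Qed.

Lemma presented_proj_monoid : monoid_morphism proj.
Proof. by split=> // x y; rewrite -projM. Qed.

Lemma presented_proj_scalable : scalable proj.
Proof. by move=> c x; rewrite -projZ. Qed.

HB.instance Definition _ :=
  GRing.isZmodMorphism.Build F H presented_proj presented_proj_zmod.
HB.instance Definition _ :=
  GRing.isMonoidMorphism.Build F H presented_proj presented_proj_monoid.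
HB.instance Definition _ :=
  GRing.isScalable.Build K F H *:%R presented_proj presented_proj_scalable.

Lemma presented_projA c : proj c%:A = c%:A.
Proof. by rewrite linearZ rmorph1. Qed.

Lemma presented_rel x y : S x y -> proj x = proj y.
Proof. by move=> Sxy; apply/projP/asboolP/IdealRel. Qed.

Lemma presented_projP x : proj x = 0 <-> two_sided_ideal x.
Proof.
rewrite -[x in two_sided_ideal x]subr0; split=> [x0|Ix].
  by apply/asboolP/projP; rewrite x0 raddf0.
by rewrite -[RHS](raddf0 proj); apply/projP/asboolP.
Qed.

Lemma presented_surj (u : H) : exists x, u = proj x.
Proof. by exists (reprH u); rewrite reprHK. Qed.
End Presentation.

Section FreeAlgebra.
Import monalg.
Variables (K : fieldType) (I : choiceType).

Definition free_alg := {malg K[{fmonom I}]}.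

HB.instance Definition _ := GRing.Lalgebra.on free_alg.

Let free_scaleAr (c : K) (x y : {malg K[{fmonom I}]}) : c *: (x * y) = x * (c *: y).
Proof.
suff cx : c%:MP * x = x * c%:MP.
  have cZ (z : {malg K[{fmonom I}]}) : c *: z = c%:MP * z by rewrite mul_malgC.
  by rewrite (cZ (x * y)) (cZ y) mulrA cx mulrA.
rewrite !malgM_def fgmulUg fgmulgU; apply: eq_bigr => k _.
by rewrite mul1m mulm1 mulrC.
Qed.

HB.instance Definition _ := GRing.Lalgebra_isAlgebra.Build K free_alg free_scaleAr.

Definition free_gen (i : I) : free_alg := << fmu i >>%R.

Section Character.
Variable f : I -> K.

Let word (w : {fmonom I}) : K := \prod_(i <- (w : seq _)) f i.

Let word_mmorph : mmorphism word.
Proof.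
by split=> [x y|]; rewrite /word ?fm1 ?big_nil // fmM big_cat.
Qed.

HB.instance Definition _ := isMultiplicative.Build _ _ word word_mmorph.

Lemma free_alg_character : exists g : {rmorphism free_alg -> K},
  (forall c, g c%:A = c) /\ (forall i, g (free_gen i) = f i).
Proof.
pose g : {rmorphism {malg K[{fmonom I}]} -> K} := mmap (@idfun K) word.
exists g; split=> [c|i]; first by rewrite /g /= -mul_malgC mulr1 mmapC.
by rewrite /g /= mmapU mul1r /word fmU big_seq1.
Qed.
End Character.
End FreeAlgebra.

Inductive hecke_rel (K : fieldType) (m n : nat) (q : 'I_m -> K)
    (A : algType K) (t : A) (s : nat -> A) : A -> A -> Prop :=
| HeckeCyclotomic :
    hecke_rel n q t s (\prod_(c < m) (t - (q c)%:A)) 0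
| HeckeTypeB of (1 < n)%N :
    hecke_rel n q t s (t * (s 1 * t * s 1 + s 1)) ((s 1 * t * s 1 + s 1) * t)
| HeckeCommT i of (2 <= i < n)%N :
    hecke_rel n q t s (t * s i) (s i * t)
| HeckeInvol i of (1 <= i < n)%N :
    hecke_rel n q t s (s i ^+ 2) 1
| HeckeBraid i of (1 <= i)%N & (i.+1 < n)%N :
    hecke_rel n q t s (s i * s i.+1 * s i) (s i.+1 * s i * s i.+1)
| HeckeComm i j of (1 <= i < n)%N & (1 <= j < n)%N
    & ((i.+1 < j) || (j.+1 < i))%N :
    hecke_rel n q t s (s i * s j) (s j * s i).

Lemma hecke_rel_character (K : fieldType) (m n : nat) (q : 'I_m -> K)
    (A : algType K) (t : A) (s : nat -> A) (g : {rmorphism A -> K}) (c : 'I_m) :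
    (forall a, g a%:A = a) -> g t = q c -> (forall i, (1 <= i < n)%N -> g (s i) = 1) ->
  forall x y, hecke_rel n q t s x y -> g x = g y.
Proof.
move=> gZ gt gs x y; case=> [|_|i i_n|i i_n|i i1 i2|i j i_n j_n _].
- rewrite rmorph_prod rmorph0; apply/eqP/prodf_eq0; exists c => //.
  by rewrite rmorphB gZ gt subrr.
- by rewrite !rmorphM mulrC.
- by rewrite !rmorphM mulrC.
- by rewrite rmorphXn gs // expr1n rmorph1.
- by rewrite !rmorphM !gs ?i1 // ltnW.
- by rewrite !rmorphM mulrC.
Qed.

Lemma hecke_rel_morph (K : fieldType) (m n : nat) (q : 'I_m -> K)
    (A B : algType K) (t : A) (s : nat -> A) (g : {rmorphism A -> B}) :
    (forall c, g c%:A = c%:A) ->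
    (forall x y, hecke_rel n q t s x y -> g x = g y) ->
  forall x y, hecke_rel n q (g t) (fun i => g (s i)) x y -> x = y.
Proof.
move=> gZ gr x y; case=> [|n1|i i_n|i i_n|i i1 i2|i j i_n j_n ij].
- have := gr _ _ (HeckeCyclotomic n q _ _); rewrite rmorph0 rmorph_prod => <-.
  by apply: eq_bigr => c _; rewrite rmorphB gZ.
- by have := gr _ _ (HeckeTypeB q _ _ n1); rewrite !(rmorphM, rmorphD).
- by have := gr _ _ (HeckeCommT q _ _ i_n); rewrite !rmorphM.
- by have := gr _ _ (HeckeInvol q _ _ i_n); rewrite rmorphXn rmorph1.
- by have := gr _ _ (HeckeBraid q _ _ i1 i2); rewrite !rmorphM.
- by have := gr _ _ (HeckeComm q _ _ i_n j_n ij); rewrite !rmorphM.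
Qed.

Section HeckeAlgebra.
Variables (K : fieldType) (m n : nat) (q : 'I_m -> K) (m_gt0 : (0 < m)%N).

(* The free algebra has n letters: letter 0 is t, letter i is t_i. *)
Definition hecke_letter (i : nat) : free_alg K 'I_n.-1.+1 := free_gen K (inord i).

Definition hecke_presentation : free_alg K 'I_n.-1.+1 -> free_alg K 'I_n.-1.+1 -> Prop :=
  hecke_rel n q (hecke_letter 0) hecke_letter.

Lemma hecke_proper : ~ two_sided_ideal hecke_presentation 1.
Proof.
pose f (i : 'I_n.-1.+1) : K := if i == ord0 then q (Ordinal m_gt0) else 1.
have [g [gZ g_gen]] := free_alg_character f.
suff g0 x : two_sided_ideal hecke_presentation x -> g x = 0.
  by move=> /g0/eqP; rewrite rmorph1 oner_eq0.
have g_rel : forall x y, hecke_presentation x y -> g x = g y.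
  apply: (@hecke_rel_character _ _ _ _ _ _ _ g (Ordinal m_gt0)) => // [|i /andP[i1 i2]].
    by rewrite g_gen /f -val_eqE /= inordK.
  rewrite g_gen /f -val_eqE /= inordK ?gtn_eqF //.
  by rewrite prednK // (ltn_trans i1).
elim=> {x} [x y /g_rel xy||x y _ x0 _ y0|a x _ x0|x a _ x0].
- by rewrite rmorphB xy subrr.
- exact: rmorph0.
- by rewrite rmorphB x0 y0 subrr.
- by rewrite rmorphM x0 mulr0.
- by rewrite rmorphM x0 mul0r.
Qed.

Definition hecke := presented hecke_proper.

HB.instance Definition _ := GRing.Algebra.on hecke.

Definition hecke_t : hecke := presented_proj hecke_proper (hecke_letter 0).
Definition hecke_s (i : nat) : hecke := presented_proj hecke_proper (hecke_letter i).
End HeckeAlgebra.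

Arguments hecke_presentation {K m} n q _ _.
Arguments hecke_proper {K m} n q m_gt0.
Arguments hecke {K m} n q m_gt0.
Arguments hecke_t {K m} n q m_gt0.
Arguments hecke_s {K m} n q m_gt0 i.

Lemma hecke_relations (K : fieldType) (m n : nat) (q : 'I_m -> K)
    (m_gt0 : (0 < m)%N) (x y : hecke n q m_gt0) :
  hecke_rel n q (hecke_t n q m_gt0) (hecke_s n q m_gt0) x y -> x = y.
Proof.
apply: (hecke_rel_morph (g := presented_proj (hecke_proper n q m_gt0))) => [c|].
  exact: presented_projA.
exact: presented_rel.
Qed.

Definition generic_value (K : fieldType) (m n : nat) (q : 'I_m -> K) : K :=
  n`!%:R * \prod_(i < m) \prod_(j < m | (i < j)%N) \prod_(k < n.*2.+1)
    ((k%:Z - n%:Z)%:~R + q i - q j).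

Record intpart := IntPart {
  intpart_seq :> seq nat;
  _ : sorted geq intpart_seq && (0%N \notin intpart_seq)
}.

HB.instance Definition _ := [isSub for intpart_seq].
HB.instance Definition _ := [Equality of intpart by <:].

Definition part_row (la : intpart) (a : nat) : nat := nth 0%N la a.-1.
Definition part_col (la : intpart) (b : nat) : nat := count (leq b) la.
Definition part_cells (la : intpart) : seq (nat * nat) :=
  [seq (a, b) | a <- iota 1 (size la), b <- iota 1 (part_row la a)].

(* All row, column, entry and generator indices are 1-based, as nat. *)
Definition node (m : nat) : Type := (nat * nat * 'I_m)%type.

Definition multipart_size (m : nat) (la : m.-tuple intpart) : nat :=
  \sum_(c < m) sumn (tnth la c).

Definition diagram (m : nat) (la : m.-tuple intpart) : seq (node m) :=
  [seq (x, c) | c <- enum 'I_m, x <- part_cells (tnth la c)].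

Definition addable (m : nat) (D : seq (node m)) (x : node m) : bool :=
  (x \notin D) && `[< exists la : m.-tuple intpart, x :: D =i diagram la >].

(* A node addable to D has coordinates at most (size D).+1, see
   [mem_addable_nodes]. *)
Definition addable_nodes (m : nat) (D : seq (node m)) : seq (node m) :=
  let range := iota 1 (size D).+1 in
  [seq x <- [seq (ab, c) | ab <- [seq (a, b) | a <- range, b <- range],
                           c <- enum 'I_m] | addable D x].

Lemma mem_part_cells (la : intpart) (a b : nat) :
  ((a, b) \in part_cells la) = [&& 0 < a, 0 < b & b <= part_row la a]%N.
Proof.
apply/allpairsPdep/and3P => [[a' [b' [+ + [-> ->]]]]|[a0 b0 b_le]].
  by rewrite !mem_iota !add1n !ltnS => /andP[-> _] /andP[-> ->].
exists a, b; rewrite !mem_iota !add1n !ltnS a0 b0 b_le; split => //=.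
rewrite leqNgt; apply: contraL b_le => a_gt; rewrite -ltnNge /part_row nth_default //.
by rewrite -ltnS prednK.
Qed.

Lemma mem_diagram (m : nat) (la : m.-tuple intpart) (a b : nat) (c : 'I_m) :
  ((a, b, c) \in diagram la) = [&& 0 < a, 0 < b & b <= part_row (tnth la c) a]%N.
Proof.
rewrite -mem_part_cells; apply/allpairsPdep/idP => [[c' [x [_ + [-> ->]]]]|abc] //.
by exists c, (a, b); rewrite mem_enum.
Qed.

Lemma part_row_le (la : intpart) (a a' : nat) :
  (0 < a' <= a)%N -> (part_row la a <= part_row la a')%N.
Proof.
have /andP[s_sorted _] := valP la => /andP[a'0 le_a]; rewrite /part_row.
have [lt_a|] := ltnP a.-1 (size la); last by move=> ?; rewrite nth_default.
have geq_trans : transitive geq by move=> x y z /= xy yz; apply: leq_trans yz xy.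
apply: (sorted_leq_nth geq_trans leqnn 0%N s_sorted); rewrite ?inE //.
  by rewrite (leq_ltn_trans _ lt_a) // -!subn1 leq_sub2r.
by rewrite -!subn1 leq_sub2r.
Qed.

Lemma mem_addable_nodes (m : nat) (D : seq (node m)) (x : node m) :
  (x \in addable_nodes D) = addable D x.
Proof.
rewrite mem_filter andb_idr //; case: x => [[a b] c] /andP[_ /asboolP[la laE]].
have: (a, b, c) \in diagram la by rewrite -laE mem_head.
rewrite mem_diagram => /and3P[a0 b0 b_le].
have bound k (f : nat -> node m) : injective f ->
    {in iota 1 k, forall i, f i \in diagram la} -> (k <= (size D).+1)%N.
  move=> f_inj fP; rewrite -(size_iota 1 k) -(size_map f) -/(size ((a, b, c) :: D)).
  apply: uniq_leq_size; first by rewrite map_inj_uniq // iota_uniq.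
  by move=> _ /mapP[i i_k ->]; rewrite laE fP.
apply/allpairsPdep; exists (a, b), c; rewrite mem_enum; split => //.
apply/allpairsPdep; exists a, b; split => //; rewrite mem_iota add1n ltnS ?a0 ?b0 /=.
  apply: (bound a (fun i => (i, b, c))) => [i j [] //|i].
  rewrite mem_iota add1n ltnS => i_a; rewrite mem_diagram b0; case/andP: (i_a) => -> _ /=.
  exact: leq_trans b_le (part_row_le _ i_a).
apply: (bound b (fun i => (a, i, c))) => [i j [] //|i].
rewrite mem_iota add1n ltnS => /andP[i0 i_b]; rewrite mem_diagram a0 i0 /=.
exact: leq_trans i_b b_le.
Qed.

Definition residue (K : fieldType) (m : nat) (q : 'I_m -> K) (x : node m) : K :=
  let: (a, b, c) := x in (b%:Z - a%:Z)%:~R + q c.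

(* A tableau is given by its entry function T on nodes; only the values of T
   on the diagram of la matter. *)
Definition is_tableau (m n : nat) (la : m.-tuple intpart) (T : node m -> nat) : Prop :=
  [/\ {in diagram la, forall x, 1 <= T x <= n}%N,
      {in diagram la &, injective T}
    & forall i, (1 <= i <= n)%N -> exists2 x, x \in diagram la & T x = i].

Definition is_standard (m : nat) (la : m.-tuple intpart) (T : node m -> nat) : Prop :=
  (forall a b b' c, (a, b, c) \in diagram la -> (a, b', c) \in diagram la ->
     (b < b')%N -> (T (a, b, c) < T (a, b', c))%N) /\
  (forall a a' b c, (a, b, c) \in diagram la -> (a', b, c) \in diagram la ->
     (a < a')%N -> (T (a, b, c) < T (a', b, c))%N).

Section Tableau.
Variables (K : fieldType) (m : nat) (q : 'I_m -> K).
Variables (la : m.-tuple intpart) (T : node m -> nat).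

Definition node_at (i : nat) : option (node m) :=
  ohead [seq x <- diagram la | T x == i].

Definition residue_at (i : nat) : K := oapp (residue q) 0 (node_at i).

Definition subdiagram (k : nat) : seq (node m) := [seq x <- diagram la | T x <= k]%N.

Definition theta_hook (mu nu : intpart) (i j : nat) : int :=
  (part_row mu i)%:Z - i%:Z + (part_col nu j)%:Z - j%:Z + 1.

Definition Theta : K :=
  \prod_(s < m) \prod_(ij <- part_cells (tnth la s)) \prod_(t < m)
    ((theta_hook (tnth la s) (tnth la t) ij.1 ij.2)%:~R + q s - q t)^-1.

Section Idempotent.
Variables (A : algType K) (t : A) (s : nat -> A).

Fixpoint jucys_murphy (i : nat) : A :=
  match i with
  | 0 => 0
  | 1 => t
  | i'.+1 => s i' * jucys_murphy i' * s i' + s i'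
  end.

Fixpoint young_idempotent (k : nat) : A :=
  if k is k'.+1 then
    young_idempotent k' *
    \prod_(x <- addable_nodes (subdiagram k') | Some x != node_at k)
      ((residue_at k - residue q x)^-1 *: (jucys_murphy k - (residue q x)%:A))
  else 1.
End Idempotent.
End Tableau.

Section RationalFunctions.
Variables (K : fieldType) (A : algType K) (n : nat).

(* Fractions num / den with num in A[z_1, .., z_n] and den nonzero in the
   central subring K[z_1, .., z_n], taken up to the equivalence [rf_eq]. *)
Record ratfun := Ratfun {
  rf_num : {mpoly A[n]};
  rf_den : {mpoly K[n]};
  rf_den_neq0 : rf_den != 0
}.

Definition mpoly_alg (d : {mpoly K[n]}) : {mpoly A[n]} := map_mpoly (in_alg A) d.

Definition rf_eq (f g : ratfun) : Prop :=
  mpoly_alg (rf_den g) * rf_num f = mpoly_alg (rf_den f) * rf_num g.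

Definition rf_poly (p : {mpoly A[n]}) : ratfun := Ratfun p (oner_neq0 _).
Definition rf_const (a : A) : ratfun := rf_poly a%:MP.

Definition rf_add (f g : ratfun) : ratfun :=
  Ratfun (mpoly_alg (rf_den g) * rf_num f + mpoly_alg (rf_den f) * rf_num g)
         (mulf_neq0 (rf_den_neq0 f) (rf_den_neq0 g)).
Definition rf_mul (f g : ratfun) : ratfun :=
  Ratfun (rf_num f * rf_num g) (mulf_neq0 (rf_den_neq0 f) (rf_den_neq0 g)).

(* 1 / d, with the usual convention 1 / 0 = 0 *)
Definition rf_inv (d : {mpoly K[n]}) : ratfun :=
  if insub d : {? d | d != 0} is Some e then Ratfun 1 (valP e) else rf_const 0.

(* The variable z_k, for 1 <= k <= n *)
Definition zvar (R : nzRingType) (k : nat) : {mpoly R[n]} :=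
  oapp (fun i : 'I_n => 'X_i) 0 (insub k.-1).

Definition mpoly_subst (R : nzRingType) (i : 'I_n) (r : R) (p : {mpoly R[n]}) :
    {mpoly R[n]} :=
  mmap (@mpolyC n R) (fun j => if j == i then r%:MP else 'X_j) p.

(* g is the value of f at z_(i+1) = r: some representative of f has a
   denominator that does not vanish identically on z_(i+1) = r. *)
Definition rf_value_at (i : 'I_n) (r : K) (f g : ratfun) : Prop :=
  exists (f' : ratfun) (d_neq0 : mpoly_subst i r (rf_den f') != 0),
    rf_eq f f' /\ rf_eq g (Ratfun (mpoly_subst i r%:A (rf_num f')) d_neq0).

(* f is regular at each stage of z_1 = r 1, then z_2 = r 2, .., then
   z_n = r n, and v is the final value. *)
Definition consecutive_value (f : ratfun) (r : nat -> K) (v : A) : Prop :=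
  exists g : nat -> ratfun,
    [/\ g 0 = f, forall i : 'I_n, rf_value_at i (r i.+1) (g i) (g i.+1)
      & rf_eq (g n) (rf_const v)].
End RationalFunctions.

Section RationalFunctionsTheory.
Variables (K : fieldType) (A : algType K) (n : nat).
Local Notation alg := (@mpoly_alg K A n).

Let mpoly_algM : {morph alg : d e / d * e}.
Proof. exact: (rmorphM (map_mpoly (in_alg A))). Qed.

Let mpoly_alg1 : alg 1 = 1.
Proof. exact: (rmorph1 (map_mpoly (in_alg A))). Qed.

Let commC (a : K) (p : {mpoly A[n]}) : GRing.comm p (a%:A%:MP).
Proof.
rewrite [p]mpolyE; apply/commr_sym/commr_sum => m _.
rewrite -mul_mpolyC; apply: commrM; last exact: commr_mpolyX.
by rewrite /GRing.comm -!mpolyCM mulr_algl mulr_algr.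
Qed.

Let mpoly_alg_comm d (p : {mpoly A[n]}) : GRing.comm p (alg d).
Proof.
rewrite /mpoly_alg /map_mpoly /mmap; apply: commr_sum => m _ /=.
by apply: commrM; [exact: commC | rewrite mmap1_id; exact: commr_mpolyX].
Qed.

Let mpoly_alg_reg d : d != 0 -> GRing.lreg (alg d).
Proof.
move=> d_neq0; have a0 : in_alg A (mleadc d) != 0.
  by rewrite fmorph_eq0 mleadc_eq0.
apply: lreg_mleadc.
have -> : mleadc (alg d) = (mleadc d)%:A.
  have supp : perm_eq (msupp (alg d)) (msupp d).
    exact: msupp_map_mpoly (fmorph_inj (in_alg A)).
  have alg_neq0 : alg d != 0.
    by rewrite -msupp_eq0 -size_eq0 (perm_size supp) size_eq0 msupp_eq0.
  have mlE : mlead (alg d) = mlead d.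
    apply: Order.POrderTheory.le_anti; rewrite !msupp_le_mlead //.
      by rewrite (perm_mem supp) mlead_supp.
    by rewrite -(perm_mem supp) mlead_supp.
  by rewrite mlE /mpoly_alg mcoeff_map_mpoly.
move=> x y; rewrite -!scalerAl !mul1r; apply: scalerI.
by rewrite mleadc_eq0.
Qed.

Let rf_eq_sym (f g : ratfun A n) : rf_eq f g -> rf_eq g f.
Proof. by rewrite /rf_eq => ->. Qed.

Let rf_eq_trans (f g h : ratfun A n) : rf_eq f g -> rf_eq g h -> rf_eq f h.
Proof.
rewrite /rf_eq => fg gh; apply: (mpoly_alg_reg (rf_den_neq0 g)).
have cc (d e : {mpoly K[n]}) x : alg d * (alg e * x) = alg e * (alg d * x).
  by rewrite !mulrA -!mpoly_algM mulrC.
by rewrite cc fg cc gh cc.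
Qed.

Section Substitution.
Variables (i : 'I_n) (r : K).
Local Notation substA := (@mpoly_subst n A i r%:A).
Local Notation substK := (@mpoly_subst n K i r).

Let substAM : {morph substA : p p' / p * p'}.
Proof.
have commr_h (j : 'I_n) x :
    GRing.comm x ((if j == i then r%:A%:MP else 'X_j) : {mpoly A[n]}).
  by case: ifP => _; [exact: commC | exact: commr_mpolyX].
move=> p p'; rewrite /mpoly_subst.
have [|H _] := @commr_mmap_is_multiplicative n A {mpoly A[n]} _ (@mpolyC n A) commr_h.
  by move=> u m m'; apply: commr_prod => j _; apply: commrX; apply: commr_h.
exact: H.
Qed.

Let subst_alg d : substA (alg d) = alg (substK d).
Proof.
rewrite /mpoly_subst.
elim/mpolyind: d => [|c m p _ _ IH].
  by rewrite /mpoly_alg !(mmap0, raddf0).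
have algD u v : alg (u + v) = alg u + alg v.
  exact: (raddfD (map_mpoly (in_alg A))).
rewrite algD !mmapD IH algD; congr (_ + _).
rewrite /mpoly_alg map_mpolyZ map_mpolyX !mmapZ !mmapX.
rewrite -[RHS]/(alg _) mpoly_algM; congr (_ * _).
  by rewrite /mpoly_alg map_mpolyC.
rewrite /mmap1 (big_morph alg mpoly_algM mpoly_alg1); apply: eq_bigr => j _.
rewrite [RHS](rmorphXn (map_mpoly (in_alg A))); congr (_ ^+ _).
by case: ifP => _; rewrite /= ?map_mpolyC ?map_mpolyX.
Qed.

Lemma rf_value_at_uniq (f f' g g' : ratfun A n) :
  rf_eq f f' -> rf_value_at i r f g -> rf_value_at i r f' g' -> rf_eq g g'.
Proof.
move=> ff' [h [d0 [fh gh]]] [h' [d0' [fh' gh']]].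
apply: rf_eq_trans gh _; apply: rf_eq_trans (rf_eq_sym gh').
have : rf_eq h h' by apply: rf_eq_trans (rf_eq_sym fh) (rf_eq_trans ff' fh').
by rewrite /rf_eq /= => /(congr1 substA); rewrite !substAM !subst_alg.
Qed.
End Substitution.

Lemma consecutive_value_uniq (f : ratfun A n) (r : nat -> K) (v w : A) :
  consecutive_value f r v -> consecutive_value f r w -> v = w.
Proof.
move=> [g [g0 gS gn]] [h [h0 hS hn]].
have gh k : (k <= n)%N -> rf_eq (g k) (h k).
  elim: k => [_|k IH k_n]; first by rewrite g0 h0 /rf_eq.
  exact: rf_value_at_uniq (IH (ltnW k_n)) (gS (Ordinal k_n)) (hS (Ordinal k_n)).
have := rf_eq_trans (rf_eq_sym gn) (rf_eq_trans (gh n (leqnn n)) hn).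
by rewrite /rf_eq /= mpoly_alg1 !mul1r => /(can_inj (@mpolyCK _ _)).
Qed.
End RationalFunctionsTheory.

Section FusionFunction.
Variables (K : fieldType) (m n : nat) (q : 'I_m -> K).
Variables (A : algType K) (t : A) (s : nat -> A).

(* t(z) = f(z) / (z - t), as an exact quotient in A[z] *)
Definition baxter_t : {poly A} :=
  Pdiv.Ring.rdivp (\prod_(c < m) ('X - (q c)%:A%:P)) ('X - t%:P).

(* t(z_j) *)
Definition rf_t (j : nat) : ratfun A n :=
  rf_poly (map_poly (@mpolyC n A) baxter_t).[zvar n A j].

(* t_k(z_i, z_j) = 1 / (z_i - z_j) + t_k *)
Definition rf_s (k i j : nat) : ratfun A n :=
  rf_add (rf_inv A (zvar n K i - zvar n K j)) (rf_const n (s k)).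

(* phi_k(z_1, .., z_(k-1); z_j), for 1 <= k *)
Fixpoint fusion_phi (k j : nat) : ratfun A n :=
  match k with
  | 0 => rf_const n 1
  | 1 => rf_t j
  | k'.+1 => rf_mul (rf_mul (rf_s k' j k') (fusion_phi k' j)) (rf_const n (s k'))
  end.

(* phi_k(z_1, .., z_k) * .. * phi_1(z_1) *)
Fixpoint fusion_Phi (k : nat) : ratfun A n :=
  if k is k'.+1 then rf_mul (fusion_phi k k) (fusion_Phi k') else rf_const n 1.
End FusionFunction.

Lemma baxter_tK (K : fieldType) (m : nat) (q : 'I_m -> K) (A : algType K) (t : A) :
    \prod_(c < m) (t - (q c)%:A) = 0 ->
  baxter_t q t * ('X - t%:P) = \prod_(c < m) ('X - (q c)%:A%:P).
Proof.
move=> ft0; rewrite /baxter_t Pdiv.RingMonic.rdivpK ?monicXsubC //.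
have cA (a : A) c' : GRing.comm a c'%:A by rewrite /GRing.comm mulr_algl mulr_algr.
have cP (p : {poly A}) c : p * (c%:A)%:P = (c%:A)%:P * p.
  by apply/polyP => k; rewrite coefCM coefMC cA.
have fC (p : {poly A}) c : (('X - c%:A%:P) * p).[t] = p.[t] * (t - c%:A).
  rewrite mulrBl -(commr_polyX p) -cP -mulrBr hornerM_comm ?hornerXsubC //.
  by rewrite /comm_poly hornerXsubC mulrBl mulrBr cA.
have prodE (l : seq 'I_m) : (\prod_(c <- l) ('X - (q c)%:A%:P)).[t]
    = \prod_(c <- l) (t - (q c)%:A).
  elim: l => [|c l IH]; first by rewrite !big_nil hornerC.
  rewrite !big_cons fC IH; apply: commr_sym; apply: commr_prod => c' _.
  by apply: commrB; [apply: commr_sym; apply: commrB|].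
by rewrite Pdiv.Ring.rdvdp_XsubCl; apply/rootP; rewrite prodE.
Qed.

(* Main.v *)
Require Import Defs.
From HB Require Import structures.
From mathcomp Require Import all_boot all_order all_algebra.
From mathcomp Require Import boolp.
From mathcomp Require Import mpoly.
From mathcomp Require Import ring lra zify.

(** Why the theorem holds.

    Write c_i for the residue of the i-th node of the tableau, E for the idempotent of the
    tableau formed by the first k - 1 nodes, and phi(z) for phi_k at z_1 = c_1, ..,
    z_(k-1) = c_(k-1), z_k = z. On E the factor phi(z) inverts z - J_k up to a scalar:

      phi(z) (z - J_k) E = f(z) prod_(i < k) (1 - 1 / (z - c_i)^2) E      ([phi_poly_jm]).

    Indeed t_k (z - J_(k+1)) = (z - J_k) t_k - 1 and J_k acts on the next idempotent by c_k,
    so passing from k to k + 1 multiplies the scalar by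
    (t_k + 1 / (z - c_k)) (t_k - 1 / (z - c_k)) = 1 - 1 / (z - c_k)^2.

    The second ingredient is the spectrum of J_k on E: P(J_k) E = 0, where P is the product
    of the z - res y over the addable nodes y ([addable_killedP]). Hence (z - J_k) E divides
    P(z) E, and phi(z) E becomes a scalar rational function times an explicit polynomial
    which at z = c_k is the product of the J_k - res y over the other addable nodes, that is
    up to a scalar the factor added to E when the k-th node is adjoined
    ([phi_poly_regular]). All possible poles at c_k cancel because
    f(z) prod (1 - 1 / (z - c_i)^2) has a reduced form indexed by the columns to the left of
    the new node and the rows above it ([strip_identity]); in this form its numerator and
    denominator at c_k are the hook factors that change when the node is added
    ([hook_prod_cons]). By induction the value after k evaluations is H_k E_k, with
    H_k the hook product of the first k nodes, and H_n is the inverse of Theta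
    ([Theta_hook_prod]).

    The spectrum is found from the defining relations alone, without constructing Specht
    modules. By induction, the relations between J_k, J_(k+1) and t_k leave for J_(k+1) only
    the residues of the other nodes that were addable with the k-th one, c_k + 1 and c_k - 1
    ([addable_killed_step]). If the right or the lower neighbour of the k-th node is not
    addable, some removable node blocks it, and the corresponding value is impossible:
    intertwiners move the blocking node next to the k-th one, producing a weight
    (.., a + e, a, a + e) with e = 1 or -1, on which t_i and t_(i+1) act by opposite signs,
    against the braid relation ([excluded_weight]). Genericity enters through the fact that
    residues of distinct addable nodes differ neither by 0 nor by 1 or -1 ([residue_sep]),
    through the invertibility of 2, and through the nonvanishing of hooks ([hook_neq0]).

    A standard tableau is represented by the list of its nodes, the last entry first; its
    tails are the smaller tableaux of the induction. *)

Set Implicit Arguments.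
Unset Strict Implicit.
Unset Printing Implicit Defensive.

Import GRing.Theory.
Local Open Scope ring_scope.

(** * Standard tableaux as stacks of nodes *)

Section Stacks.
Variable m : nat.
Implicit Types (D : seq (node m)) (x y : node m) (c : 'I_m).
Local Open Scope nat_scope.

(** Addability of a node as a local condition, for D a diagram. *)
Definition corner D x : bool :=
  let: (a, b, c) := x in
  [&& 0 < a, 0 < b, (a, b, c) \notin D,
      (a == 1) || ((a.-1, b, c) \in D) & (b == 1) || ((a, b.-1, c) \in D)].

(** The last entry of the tableau is the head, so that the successive tails are the
    shapes through which the tableau grows. *)
Fixpoint stacked D : bool := if D is x :: D' then corner D' x && stacked D' else true.

Definition row D a c := count (fun y => (y.1.1 == a) && (y.2 == c)) D.
Definition col D b c := count (fun y => (y.1.2 == b) && (y.2 == c)) D.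

Lemma eq_corner D D' : D =i D' -> corner D =1 corner D'.
Proof. by move=> DD' [[a b] c]; rewrite /= !DD'. Qed.

Lemma corner_notin D x : corner D x -> x \notin D.
Proof. by case: x => [[a b] c] /and5P[]. Qed.

Lemma stacked_uniq D : stacked D -> uniq D.
Proof. by elim: D => //= x D IH /andP[/corner_notin -> /IH]. Qed.

Lemma stacked_cat D1 D2 : stacked (D1 ++ D2) -> stacked D2.
Proof. by elim: D1 => //= x D1 IH /andP[_ /IH]. Qed.

(** Rows of a stack are initial segments, because a node is stacked only to the right
    of its left neighbour. *)
Lemma mem_row D : stacked D -> forall a b c,
  ((a, b, c) \in D) = [&& 0 < a, 0 < b & b <= row D a c].
Proof.
elim: D => [_ a b c|[[i j] k] D IH /= /andP[/and5P[i0 j0 nD _ lD] /IH{}IH] a b c].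
  by rewrite in_nil /row /= leqn0; case: b => [|b] /=; rewrite ?andbF.
have rowE : row D i k = j.-1.
  move: nD lD; rewrite !IH i0 j0 /=; case: (eqVneq j 1) => [-> /= | _ /=]; lia.
rewrite inE IH !xpair_eqE /row /= -/(row D a c) eq_sym [k == c]eq_sym.
case: (eqVneq a i) => [->|] //=; case: (eqVneq c k) => [->|] //=; last by rewrite andbF.
by rewrite rowE i0 /=; apply/idP/idP; lia.
Qed.

Lemma mem_col D : stacked D -> forall a b c,
  ((a, b, c) \in D) = [&& 0 < a, 0 < b & a <= col D b c].
Proof.
elim: D => [_ a b c|[[i j] k] D IH /= /andP[/and5P[i0 j0 nD uD _] /IH{}IH] a b c].
  by rewrite in_nil /col /= leqn0; case: a => [|a] /=; rewrite ?andbF.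
have colE : col D j k = i.-1.
  move: nD uD; rewrite !IH i0 j0 /=; case: (eqVneq i 1) => [-> /= | _ /=]; lia.
rewrite inE IH !xpair_eqE /col /= -/(col D b c) eq_sym [k == c]eq_sym.
case: (eqVneq b j) => [->|] //=; last by rewrite andbF.
rewrite eq_sym; case: (eqVneq c k) => [->|] //=; last by rewrite andbF.
by rewrite colE j0 /= andbT; apply/idP/idP; lia.
Qed.

Lemma row_corner D a b c : stacked D -> corner D (a, b, c) -> row D a c = b.-1.
Proof.
move=> sD /and5P[a0 b0]; rewrite !(mem_row sD) a0 b0 /= => nD _.
by case: (eqVneq b 1) nD => [-> /= | _ /=]; lia.
Qed.

Lemma col_corner D a b c : stacked D -> corner D (a, b, c) -> col D b c = a.-1.
Proof.
move=> sD /and5P[a0 b0]; rewrite !(mem_col sD) a0 b0 /= => nD + _.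
by case: (eqVneq a 1) nD => [-> /= | _ /=]; lia.
Qed.

Lemma mem_le D a b a' b' c : stacked D -> (a, b, c) \in D ->
  0 < a' <= a -> 0 < b' <= b -> (a', b', c) \in D.
Proof.
move=> sD; rewrite (mem_row sD) => /and3P[a0 b0 ab] a'a b'b.
have: (a, b', c) \in D by rewrite (mem_row sD); lia.
by rewrite !(mem_col sD); lia.
Qed.

(** A row and a column share at most one node, and none if their components differ.
    All bounds on contents and hooks needed for genericity follow from this count. *)
Lemma row_col_le D a b c c' : stacked D ->
  row D a c + col D b c' <= size D + (c == c').
Proof.
move=> /stacked_uniq uD; rewrite /row /col -count_predUI leq_add ?count_size //.
case: eqVneq => [<-|cc'].
  apply: leq_trans (_ : count_mem (a, b, c) D <= 1); last by rewrite count_uniq_mem // leq_b1.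
  apply: sub_count => -[[i j] k] /= /andP[/andP[/eqP-> /eqP->] /andP[/eqP-> _]].
  exact: eqxx.
rewrite leqn0 eqn0Ngt -has_count; apply/hasPn => -[[i j] k] _ /=.
apply/negP => /andP[/andP[_ /eqP kc] /andP[_ /eqP kc']].
by rewrite -kc -kc' eqxx in cc'.
Qed.

(** The row lengths are non-increasing because columns are initial segments. *)
Lemma stacked_diagram D : stacked D -> exists la : m.-tuple intpart, D =i diagram la.
Proof.
move=> sD.
pose rows c := mkseq (fun a => row D a.+1 c) (col D 1 c).
have rowsP c : sorted geq (rows c) && (0 \notin rows c).
  apply/andP; split.
    apply/(sortedP 0) => i; rewrite size_mkseq => i_lt; rewrite !nth_mkseq //; last exact: ltnW.
    have := mem_row sD i.+2 (row D i.+2 c) c; rewrite leqnn !andbT /= => E.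
    case: (posnP (row D i.+2 c)) => [->|r0] //; rewrite r0 in E.
    have: (i.+1, row D i.+2 c, c) \in D by apply: mem_le E _ _; rewrite ?leqnn ?r0 ?leqnSn.
    by rewrite (mem_row sD) => /and3P[].
  apply/negP => /mapP[i]; rewrite mem_iota add0n => i_lt E.
  have: (i.+1, 1, c) \in D by rewrite (mem_col sD).
  by rewrite (mem_row sD) -E.
exists [tuple IntPart (rowsP c) | c < m] => -[[a b] c].
rewrite mem_diagram tnth_mktuple /part_row /=.
case: (ltnP a.-1 (col D 1 c)) => [a_lt|a_ge].
  rewrite nth_mkseq // (mem_row sD); case: a a_lt => //.
rewrite nth_default ?size_mkseq // leqn0.
have -> : [&& 0 < a, 0 < b & b == 0] = false by lia.
apply/negP => abc; have := abc; rewrite (mem_row sD) => /and3P[a0 b0 _].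
have: (a, 1, c) \in D by apply: mem_le abc _ _; rewrite ?leqnn ?a0 ?b0.
by rewrite (mem_col sD); lia.
Qed.

Lemma diagram_corner D x (la : m.-tuple intpart) :
  x \notin D -> x :: D =i diagram la -> corner D x.
Proof.
case: x => [[a b] c] nD E /=; have := mem_head (a, b, c) D; rewrite E mem_diagram.
case/and3P => a0 b0 ab; rewrite a0 b0 nD /=; apply/andP; split.
  case: eqVneq => //= a1; have := E (a.-1, b, c).
  rewrite inE !xpair_eqE mem_diagram b0.
  have -> : (a.-1 == a) = false by lia.
  move=> /= ->; rewrite (leq_trans ab) ?andbT; first by lia.
  by apply: part_row_le; lia.
case: eqVneq => //= b1; have := E (a, b.-1, c); rewrite inE !xpair_eqE mem_diagram a0 eqxx.
have -> : (b.-1 == b) = false by lia.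
by move=> /= ->; lia.
Qed.

(** From left to right, a diagram contains the left and upper neighbours of its nodes;
    from right to left, the enlarged list is again stacked, hence a diagram. *)
Lemma addableE D : stacked D -> addable D =1 corner D.
Proof.
move=> sD x; apply/andP/idP => [[nD /asboolP[la]]|cx]; first exact: diagram_corner.
split; first exact: corner_notin cx.
by apply/asboolP/stacked_diagram; rewrite /= cx.
Qed.

Lemma addable_nodesE D x : stacked D -> (x \in addable_nodes D) = corner D x.
Proof. by move=> sD; rewrite mem_addable_nodes addableE. Qed.

Lemma addable_nodes_uniq D : uniq (addable_nodes D).
Proof.
rewrite filter_uniq //; apply: allpairs_uniq; rewrite ?enum_uniq //; last first.
  by move=> [[? ?] ?] [[? ?] ?] _ _ [-> -> ->].
apply: allpairs_uniq; rewrite ?iota_uniq //.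
by move=> [? ?] [? ?] _ _ [-> ->].
Qed.

Lemma eq_addable_nodes D D' : D =i D' -> size D = size D' ->
  addable_nodes D = addable_nodes D'.
Proof.
move=> DD' sz; rewrite /addable_nodes sz; apply: eq_filter => x; rewrite /addable DD'.
by congr (_ && `[< _ >]); apply/propext; split=> -[la E]; exists la => y;
  rewrite -E !inE DD'.
Qed.

(** Neither node can lie weakly north-west of the other, which would put it inside the
    diagram.  This forces the contents of two addable nodes to differ by at least 2. *)
Lemma corner_lt D a b a' b' c : stacked D -> corner D (a, b, c) -> corner D (a', b', c) ->
  (a, b) != (a', b') -> (a < a') && (b' < b) || (a' < a) && (b < b').
Proof.
move=> sD cx cy ne.
have := row_corner sD cx; have := row_corner sD cy.
have := col_corner sD cx; have := col_corner sD cy.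
have/and5P[a0 b0 nx _ _] := cx; have/and5P[a'0 b'0 ny _ _] := cy => e1 e2 e3 e4.
have H (i j i' j' : nat) : 0 < i -> 0 < j -> (i, j, c) \notin D -> corner D (i', j', c) ->
    (i, j) != (i', j') -> ~~ ((i <= i') && (j <= j')).
  move=> i0 j0 nD /and5P[_ _ _ u l] {}ne; apply: contra nD => /andP[ii' jj'].
  have [e|ne_i] := eqVneq i i'.
    have jne : j != j' by move: ne; rewrite e xpair_eqE eqxx.
    have j1 : (j' == 1) = false by lia.
    by rewrite j1 /= in l; apply: mem_le l _ _ => //; lia.
  have i1 : (i' == 1) = false by lia.
  by rewrite i1 /= in u; apply: mem_le u _ _ => //; lia.
have := H _ _ _ _ a0 b0 nx cy ne.
rewrite eq_sym in ne; have := H _ _ _ _ a'0 b'0 ny cx ne.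
lia.
Qed.

End Stacks.

(** * Separation of residues *)

Section Genericity.
Variables (K : fieldType) (m n : nat) (q : 'I_m -> K).

(** The form in which the nonvanishing of P_H(Q) is used: the factor n! makes the nonzero
    integers of absolute value at most n invertible, the other factors separate the q_i. *)
Definition generic : Prop :=
  (forall d : int, d != 0 -> (`|d| <= n)%N -> d%:~R != 0 :> K) /\
  (forall (i j : 'I_m) (d : int), i != j -> (`|d| <= n)%N -> d%:~R + q i - q j != 0).

Lemma generic_valueP : generic_value n q != 0 -> generic.
Proof.
rewrite mulf_eq0 negb_or => /andP[fact_neq0 /prodf_neq0 diff_neq0]; split=> [d d0 dn|].
  suff: (`|d|%:R != 0 :> K).
    by case: (intP d) => // k; rewrite ?abszN // rmorphN oppr_eq0.
  apply: contra fact_neq0 => /eqP d_eq0.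
  have: (`|d| %| n`!)%N by rewrite dvdn_fact // absz_gt0 d0.
  by case/dvdnP => k ->; rewrite natrM d_eq0 mulr0.
have lt_case (i j : 'I_m) (d : int) : (i < j)%N -> (`|d| <= n)%N -> d%:~R + q i - q j != 0.
  move=> ij dn; have /prodf_neq0/(_ j ij)/prodf_neq0 := diff_neq0 i isT.
  have dN : (`|(d + n%:Z)%R| < n.*2.+1)%N by lia.
  move/(_ (Ordinal dN) isT) => /=; congr (_%:~R + _ - _ != 0); lia.
move=> i j d; rewrite neq_ltn => /orP[ij|ji] dn; first exact: lt_case.
have := lt_case _ _ (- d) ji; rewrite abszN => /(_ dn).
by rewrite -oppr_eq0 rmorphN; congr (_ != 0); ring.
Qed.

(** In one component the contents differ by at least 2 and at most size D + 1
    ([corner_lt], [row_col_le]); across components the bound is size D.  The separation of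
    the residues by 1 and -1 costs one more unit, whence the condition on the size. *)
Lemma residue_sep (D : seq (node m)) (x y : node m) (e : int) :
  generic -> stacked D -> corner D x -> corner D y -> x != y ->
  (`|e| <= 1)%N -> (size D + `|e| < n)%N -> residue q x - residue q y - e%:~R != 0.
Proof.
move=> [gen1 gen2] sD; case: x => [[a b] c]; case: y => [[a' b'] c'] cx cy ne e1 szD.
have [rx ry] := (row_corner sD cx, row_corner sD cy).
have [kx ky] := (col_corner sD cx, col_corner sD cy).
have/and3P[a0 b0 _] := cx; have/and3P[a'0 b'0 _] := cy.
rewrite /residue.
have [cc|cc] := eqVneq c c'; last first.
  have := gen2 c c' ((b%:Z - a%:Z) - (b'%:Z - a'%:Z) - e) cc.
  have := row_col_le a b' c c' sD; have := row_col_le a' b c' c sD.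
  rewrite eq_sym (negbTE cc) rx ry kx ky => h1 h2 /(_ ltac:(lia)).
  by rewrite !rmorphB; congr (_ != 0); ring.
rewrite -{}cc in cy ne ry ky *.
have := gen1 ((b%:Z - a%:Z) - (b'%:Z - a'%:Z) - e).
have := row_col_le a b' c c sD; have := row_col_le a' b c c sD.
rewrite eqxx rx ry kx ky => h1 h2.
have ab : (a, b) != (a', b') by move: ne; rewrite xpair_eqE eqxx andbT.
have := corner_lt sD cx cy ab => h3 /(_ ltac:(lia) ltac:(lia)).
by rewrite !rmorphB; congr (_ != 0); ring.
Qed.

End Genericity.

(** * Jucys-Murphy elements *)

Section JucysMurphy.
Variables (K : fieldType) (m n : nat) (q : 'I_m -> K).
Variables (A : algType K) (t : A) (s : nat -> A).
Hypothesis rel : forall x y, hecke_rel n q t s x y -> x = y.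

Local Notation J := (jucys_murphy t s).

Lemma jm_succ k : (0 < k)%N -> J k.+1 = s k * J k * s k + s k.
Proof. by case: k. Qed.

Lemma s_invol k : (1 <= k < n)%N -> s k * s k = 1.
Proof. by move=> kn; rewrite -expr2; apply: rel; apply: HeckeInvol. Qed.

Lemma s_braid k : (0 < k)%N -> (k.+1 < n)%N -> s k * s k.+1 * s k = s k.+1 * s k * s k.+1.
Proof. by move=> k0 kn; apply: rel; apply: HeckeBraid. Qed.

Lemma s_jm k : (1 <= k < n)%N -> s k * J k.+1 = J k * s k + 1.
Proof.
move=> /[dup] kn /andP[k0 _]; rewrite jm_succ // mulrDr s_invol //.
by rewrite !mulrA s_invol // mul1r.
Qed.

Lemma jm_s k : (1 <= k < n)%N -> J k.+1 * s k = s k * J k + 1.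
Proof.
move=> /[dup] kn /andP[k0 _]; rewrite jm_succ // mulrDl s_invol //.
by rewrite -!mulrA s_invol // mulr1.
Qed.

Lemma jm_comm_s_above j i : (0 < j < i)%N -> (i < n)%N -> GRing.comm (J j) (s i).
Proof.
move=> /andP[]; elim: j => // -[_ _ i1 iN|j IH _ ji iN].
  by apply: rel; apply: HeckeCommT; rewrite i1.
rewrite jm_succ //; have Jj : GRing.comm (s i) (J j.+1) by apply/commr_sym/IH => //; lia.
have sj : GRing.comm (s i) (s j.+1) by apply: rel; apply: HeckeComm => //; lia.
by apply: commr_sym; apply: commrD => //; do 2?apply: commrM.
Qed.

(** The case that uses the braid relation: writing J_(l+2) as a conjugate of J_l by
    t_(l+1) t_l plus lower terms, t_l passes through the conjugation and becomes t_(l+1),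
    which commutes with J_l. *)
Lemma jm_comm_s_step l : (0 < l)%N -> (l.+1 < n)%N -> GRing.comm (s l) (J l.+2).
Proof.
move=> l0 ln; have sl : s l * s l = 1 by apply: s_invol; lia.
have sl1 : s l.+1 * s l.+1 = 1 by apply: s_invol; lia.
have br := s_braid l0 ln.
have Js : s l.+1 * J l = J l * s l.+1 by apply/commr_sym/jm_comm_s_above; lia.
have jm2E : J l.+2 = s l.+1 * s l * J l * s l * s l.+1 + s l.+1 * s l * s l.+1 + s l.+1.
  by rewrite (jm_succ (ltn0Sn l)) (jm_succ l0) mulrDr mulrDl !mulrA.
have slide : s l * (s l.+1 * s l * J l * s l * s l.+1) =
             s l.+1 * s l * J l * s l * s l.+1 * s l.
  rewrite !mulrA br -!mulrA; congr (_ * (_ * _)).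
  by rewrite 2!mulrA Js -!mulrA; congr (_ * _); rewrite mulrA -br -mulrA.
rewrite /GRing.comm jm2E !(mulrDl, mulrDr) slide -!addrA; congr (_ + _).
by rewrite -br !mulrA sl mul1r -[_ * _ * s l]mulrA sl mulr1 addrC.
Qed.

Lemma jm_comm_s_below k l : (0 < l)%N -> (l.+1 < k <= n)%N -> GRing.comm (s l) (J k).
Proof.
move=> l0 /andP[]; elim: k => // k IH; rewrite ltnS leq_eqVlt => /predU1P[<- kn|lk kn].
  exact: jm_comm_s_step.
have k0 : (0 < k)%N by lia.
have sk : GRing.comm (s l) (s k) by apply: rel; apply: HeckeComm => //; lia.
rewrite jm_succ //; have := IH lk (ltnW kn) => Jk.
by apply: commrD => //; do 2?apply: commrM.
Qed.

Lemma jm_comm_lt k l : (0 < l < k)%N -> (k <= n)%N -> GRing.comm (J l) (J k).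
Proof.
elim: k l => [|k IH] l; rewrite ?ltn0 ?andbF // => /andP[l0].
rewrite ltnS leq_eqVlt => /predU1P[lk|lk] kn.
  subst l; case: k l0 IH kn => // -[_ _ n1|l _ IH ln].
    by apply: rel; apply: HeckeTypeB.
  have Jl : GRing.comm (J l.+1) (J l.+3).
    rewrite (jm_succ (ltn0Sn l.+1)).
    have s1 : GRing.comm (J l.+1) (s l.+2) by apply: jm_comm_s_above; lia.
    have J2 : GRing.comm (J l.+1) (J l.+2) by apply: IH; lia.
    by apply: commrD => //; do 2?apply: commrM.
  have sl : GRing.comm (s l.+1) (J l.+3) by apply: jm_comm_s_below; lia.
  apply: commr_sym; rewrite (jm_succ (ltn0Sn l)).
  by apply: commrD; [do 2?apply: commrM|]; apply: commr_sym.
have k0 : (0 < k)%N by lia.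
rewrite jm_succ //; have Jk : GRing.comm (J l) (J k) by apply: IH; lia.
have sk : GRing.comm (J l) (s k) by apply: jm_comm_s_above; lia.
by apply: commrD => //; do 2?apply: commrM.
Qed.

Lemma jm_comm k l : (0 < l <= n)%N -> (0 < k <= n)%N -> GRing.comm (J l) (J k).
Proof.
move=> ln kn; case: (ltngtP l k) => [lk|kl|->] //.
  by apply: jm_comm_lt; lia.
by apply/commr_sym/jm_comm_lt; lia.
Qed.

End JucysMurphy.

(** * Weights of the Jucys-Murphy elements *)

Local Arguments jucys_murphy : simpl never.

Section PolynomialActions.
Variables (K : fieldType) (A : algType K).
Implicit Types (a b g h u : A) (p : {poly K}).

Lemma horner_alg_comm g a p : GRing.comm g a -> GRing.comm g (horner_alg a p).
Proof.
move=> ga; elim/poly_ind: p => [|p c IH]; first by rewrite rmorph0; exact: commr0.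
rewrite rmorphD rmorphM /= horner_algX horner_algC; apply: commrD.
  exact: commrM.
by rewrite /GRing.comm mulr_algl mulr_algr.
Qed.

Lemma horner_alg_eigen a h (c : K) p : a * h = c *: h -> horner_alg a p * h = p.[c] *: h.
Proof.
move=> ah; elim/poly_ind: p => [|p d IH]; first by rewrite rmorph0 horner0 mul0r scale0r.
rewrite rmorphD rmorphM /= horner_algX horner_algC mulrDl -mulrA ah -scalerAr IH.
by rewrite mulr_algl scalerA -scalerDl hornerMXaddC mulrC.
Qed.

Lemma horner_alg_intertwine a b u p : a * u = u * b -> horner_alg a p * u = u * horner_alg b p.
Proof.
move=> aub; elim/poly_ind: p => [|p d IH]; first by rewrite !rmorph0 mul0r mulr0.
rewrite !rmorphD !rmorphM /= !horner_algX !horner_algC mulrDl mulrDr -mulrA aub.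
by rewrite mulrA IH -mulrA mulr_algl mulr_algr.
Qed.

End PolynomialActions.

Section Weights.
Variables (K : fieldType) (m n : nat) (q : 'I_m -> K).
Variables (A : algType K) (t : A) (s : nat -> A).
Hypothesis rel : forall x y, hecke_rel n q t s x y -> x = y.
Hypothesis gen : generic n q.

Local Notation J := (jucys_murphy t s).
Local Notation res := (residue q).
Implicit Types (D U : seq (node m)) (x y : node m) (h g : A).

Definition addable_poly D : {poly K} := \prod_(y <- addable_nodes D) ('X - (res y)%:P).
(** The numerator of the interpolation polynomial that is 1 at the residue of x and 0 at
    the residues of the other addable nodes. *)
Definition addable_poly_but D x : {poly K} :=
  \prod_(y <- addable_nodes D | y != x) ('X - (res y)%:P).

(** The recursion defining E_t, for arbitrary stacks.  The spectral argument leaves the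
    given tableau and needs these elements for all of them. *)
Fixpoint stack_idempotent D : A :=
  if D is x :: D' then
    stack_idempotent D' * ((addable_poly_but D' x).[res x]^-1 *:
      horner_alg (J (size D)) (addable_poly_but D' x))
  else 1.
Local Notation E := stack_idempotent.

(** Joint eigenvectors in the left regular module take the place of weight vectors of
    representations, so that eigenvalues can be excluded inside the algebra itself. *)
Fixpoint weight D h : Prop :=
  if D is x :: D' then J (size D) * h = res x *: h /\ weight D' h else True.

(** On the idempotent of each stack of size k, J_(k+1) is diagonalisable and its eigenvalues
    are residues of addable nodes. *)
Definition addable_killed k : Prop :=
  forall D, stacked D -> size D = k -> horner_alg (J k.+1) (addable_poly D) * E D = 0.

Lemma addable_polyE D x : stacked D -> corner D x ->
  addable_poly D = ('X - (res x)%:P) * addable_poly_but D x.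
Proof.
move=> sD cx; rewrite /addable_poly (bigD1_seq x) ?addable_nodes_uniq //=.
by rewrite addable_nodesE.
Qed.

Lemma addable_poly_but_neq0 D x : stacked D -> corner D x -> (size D < n)%N ->
  (addable_poly_but D x).[res x] != 0.
Proof.
move=> sD cx szD; rewrite horner_prod prodf_seq_neq0; apply/allP => y.
rewrite addable_nodesE // hornerXsubC => cy; apply/implyP => yx.
rewrite -[_ - _]subr0 -[0]/((0 : int)%:~R); apply: (residue_sep gen sD) => //.
  by rewrite eq_sym.
by rewrite addn0.
Qed.

Lemma weight_mulr D h g : weight D h -> weight D (h * g).
Proof. by elim: D => //= x D IH [Jh /IH]; rewrite mulrA Jh scalerAl. Qed.

Lemma weight_scale_add D h g (a : K) : weight D h -> weight D g -> weight D (a *: h + g).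
Proof.
elim: D => //= x D IH [Jh wh] [Jg wg]; split; last exact: IH.
by rewrite mulrDr -scalerAr Jh Jg scalerDr !scalerA mulrC.
Qed.

Lemma weight_mull D h g : (forall i, (0 < i <= size D)%N -> GRing.comm g (J i)) ->
  weight D h -> weight D (g * h).
Proof.
elim: D => //= x D IH gJ [Jh wh]; split; last by apply: IH => // i iD; apply: gJ; lia.
by rewrite mulrA -gJ ?leqnn // -mulrA Jh scalerAr.
Qed.

Lemma weight_cat D1 D2 h : weight (D1 ++ D2) h -> weight D2 h.
Proof. by elim: D1 => //= x D1 IH [_ /IH]. Qed.

Lemma stack_idempotent_comm D g :
  (forall i, (0 < i <= size D)%N -> GRing.comm g (J i)) -> GRing.comm g (E D).
Proof.
elim: D => [_|x D IH gJ] /=; first exact: commr1.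
apply: commrM; first by apply: IH => i iD; apply: gJ => /=; lia.
have gP := horner_alg_comm (addable_poly_but D x) (gJ (size D).+1 ltac:(by rewrite leqnn)).
by rewrite /GRing.comm -scalerAr gP scalerAl.
Qed.

(** [E D] is the product of the interpolation polynomials that take the value 1 on
    the weight of [D]; genericity makes their denominators nonzero. *)
Lemma stack_idempotent_weight D h : stacked D -> (size D <= n)%N -> weight D h -> E D * h = h.
Proof.
elim: D => [|x D IH] /=; first by rewrite mul1r.
move=> /andP[cx sD] szD [Jh wh]; rewrite -mulrA -scalerAl (horner_alg_eigen _ Jh).
by rewrite scalerA mulVf ?scale1r ?IH ?addable_poly_but_neq0 // ltnW.
Qed.

Lemma stack_idempotent_jm D i : (size D <= n)%N -> (0 < i <= n)%N -> GRing.comm (J i) (E D).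
Proof.
by move=> szD iN; apply: stack_idempotent_comm => j jD; apply: (jm_comm rel) => //; lia.
Qed.

(** Multiplying by J - res x completes the interpolation polynomial of x to the one that
    kills the idempotent of the preceding stack. *)
Lemma weight_stack_idempotent D : stacked D -> (size D <= n)%N ->
  (forall j, (j < size D)%N -> addable_killed j) -> weight D (E D).
Proof.
elim: D => //= x D IH /andP[cx sD] szD Bk; split; last first.
  by apply: weight_mulr; apply: IH => // [|j jD]; [exact: ltnW | apply: Bk; exact: ltnW].
have JE : GRing.comm (J (size D).+1) (E D) by apply: stack_idempotent_jm => //; lia.
have EJ := horner_alg_comm (addable_poly D) (commr_sym JE).
have := Bk _ (ltnSn _) D sD erefl; rewrite -EJ (addable_polyE sD cx) rmorphM rmorphB /=.
rewrite horner_algX horner_algC mulrBl mulrBr => /eqP; rewrite subr_eq0 => /eqP JE0.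
by rewrite -!scalerAr mulrA JE -mulrA JE0 mulr_algl -scalerAr !scalerA mulrC.
Qed.

(** A weight vector is fixed by its idempotent, on which the polynomial of the addable
    nodes vanishes; so a further eigenvalue must be one of its roots. *)
Lemma weight_support D h (b : K) : stacked D -> (size D < n)%N -> addable_killed (size D) ->
  weight D h -> J (size D).+1 * h = b *: h -> (addable_poly D).[b] != 0 -> h = 0.
Proof.
move=> sD szD Bk wh Jh pb; have := Bk D sD erefl => /(congr1 ( *%R^~ h)).
rewrite -mulrA stack_idempotent_weight // ?(ltnW szD) // mul0r (horner_alg_eigen _ Jh).
by move/eqP; rewrite scaler_eq0 (negbTE pb) => /eqP.
Qed.

(** The vector (s_k (J_k - J_(k+1)) + 1) h when J_k and J_(k+1) act on h by a and b. *)
Definition intertwine k (a b : K) h := (a - b) *: (s k * h) + h.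

(** Intertwiners exchange two consecutive eigenvalues, and are invertible unless these
    differ by 1 or -1. *)
Lemma intertwineP k (a b : K) h : (0 < k < n)%N -> J k * h = a *: h -> J k.+1 * h = b *: h ->
  [/\ J k * intertwine k a b h = b *: intertwine k a b h,
      J k.+1 * intertwine k a b h = a *: intertwine k a b h
    & intertwine k b a (intertwine k a b h) = (1 - (a - b) ^+ 2) *: h].
Proof.
move=> kn Xh Yh; have sX := s_jm rel kn; have sY := jm_s rel kn; have ss := s_invol rel kn.
have Xsh : J k * (s k * h) = b *: (s k * h) - h.
  by rewrite mulrA -[J k * s k](addrK 1) -sX mulrBl mul1r -mulrA Yh scalerAr.
have Ysh : J k.+1 * (s k * h) = a *: (s k * h) + h.
  by rewrite mulrA sY mulrDl mul1r -mulrA Xh scalerAr.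
rewrite /intertwine; split.
- rewrite mulrDr -scalerAr Xsh Xh scalerBr scalerDr !scalerA [b * _]mulrC -!addrA.
  by congr (_ + _); rewrite -scaleNr -scalerDl; congr (_ *: _); ring.
- rewrite mulrDr -scalerAr Ysh Yh !scalerDr !scalerA [a * _]mulrC -!addrA.
  by congr (_ + _); rewrite -scalerDl; congr (_ *: _); ring.
- rewrite mulrDr -scalerAr mulrA ss mul1r scalerDr !scalerA addrA -[_ + _ + _ *: (s k * h)]addrA.
  rewrite -scalerDl (_ : b - a + (a - b) = 0) ?scale0r ?addr0; last by ring.
  by rewrite -[X in _ + X]scale1r -scalerDl; congr (_ *: _); ring.
Qed.

Lemma weight_swap D2 D0 x y h : (size (D2 ++ y :: x :: D0) <= n)%N ->
  weight (D2 ++ y :: x :: D0) h ->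
  weight (D2 ++ x :: y :: D0) (intertwine (size D0).+1 (res x) (res y) h).
Proof.
elim: D2 => [|z D2 IH] /=.
  move=> szD [Jy [Jx w0]]; have [|Xh Yh _] := intertwineP _ Jx Jy; first by lia.
  split=> //; split=> //; apply: weight_scale_add => //; apply: weight_mull => // i iD.
  by apply/commr_sym/(jm_comm_s_above rel); lia.
move=> szD [Jz w]; split; last by apply: IH => //; exact: ltnW.
have -> : size (D2 ++ x :: y :: D0) = size (D2 ++ y :: x :: D0) by rewrite !size_cat.
have sJ : GRing.comm (s (size D0).+1) (J (size (D2 ++ y :: x :: D0)).+1).
  by apply: (jm_comm_s_below rel) => //; move: szD; rewrite size_cat /=; lia.
by rewrite /intertwine mulrDr -scalerAr mulrA -sJ -mulrA Jz scalerDr -scalerAr !scalerA mulrC.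
Qed.

End Weights.

(** * The spectrum of a Jucys-Murphy element *)

Section Exclusion.
Variables (m : nat).
Implicit Types (D U : seq (node m)) (x y : node m).
Local Open Scope nat_scope.

(** Removability of a node known to belong to the diagram U. *)
Definition removable U x : bool :=
  let: (a, b, c) := x in ((a, b.+1, c) \notin U) && ((a.+1, b, c) \notin U).

Lemma eq_removable U U' : U =i U' -> removable U =1 removable U'.
Proof. by move=> UU' [[a b] c]; rewrite /= !UU'. Qed.

Lemma corner_pop D x y : corner (x :: D) y -> removable (y :: D) x -> corner D y && (x != y).
Proof.
case: x => [[a b] c]; case: y => [[i j] k] /=.
rewrite !inE !negb_or => /and5P[i0 j0 /andP[nxy nyD] u l] /andP[/andP[n1 n2] /andP[n3 n4]].
rewrite i0 j0 nyD [_ == (i, j, k)]eq_sym nxy andbT /=; apply/andP; split.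
  case: (eqVneq i 1) u => //= i1 => /orP[|//] /eqP[e1 e2 e3].
  by move: n3; rewrite -e1 -e2 -e3 prednK ?eqxx.
case: (eqVneq j 1) l => //= j1 => /orP[|//] /eqP[e1 e2 e3].
by move: n1; rewrite -e1 -e2 -e3 prednK ?eqxx.
Qed.

Lemma corner_push D x y : corner D x -> x != y -> corner (y :: D) x.
Proof.
case: x => [[a b] c] /= /and5P[-> -> nD u l] xy; rewrite !inE negb_or xy nD /=.
by apply/andP; split; [case/orP: u => -> | case/orP: l => ->]; rewrite ?orbT.
Qed.

(** A removable node is not a neighbour of the node stacked just after it, so the two
    can be stacked in either order. *)
Lemma stacked_swap D2 D0 x y : removable (D2 ++ y :: x :: D0) x ->
  stacked (D2 ++ y :: x :: D0) ->
  [/\ stacked (D2 ++ x :: y :: D0), corner D0 x, corner D0 y & x != y].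
Proof.
move=> rx; elim: D2 rx => [|z D2 IH] /= rx.
  case/and3P => cy cx s0; have /andP[cy' xy] : corner D0 y && (x != y).
    apply: corner_pop cy _; move: rx; case: (x) => [[a b] c] /=.
    by rewrite !inE !negb_or => /andP[/and3P[-> _ ->] /and3P[-> _ ->]].
  by split=> //; rewrite cy' s0 corner_push.
case/andP => cz sD; case: IH => // [|sD' cx cy xy].
  by move: rx; case: (x) => [[a b] c] /=; rewrite !inE !negb_or => /andP[/andP[_ ->] /andP[_ ->]].
split=> //; rewrite sD' andbT; rewrite (eq_corner (D' := D2 ++ y :: x :: D0)) // => w.
by rewrite !mem_cat !inE; congr (_ || _); rewrite orbCA.
Qed.

End Exclusion.

Section Spectrum.
Variables (K : fieldType) (m n : nat) (q : 'I_m -> K).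
Variables (A : algType K) (t : A) (s : nat -> A).
Hypothesis rel : forall x y, hecke_rel n q t s x y -> x = y.
Hypothesis gen : generic n q.

Local Notation J := (jucys_murphy t s).
Local Notation res := (residue q).
Local Notation E := (stack_idempotent q t s).
Local Notation weight := (weight q t s).
Local Notation addable_killed := (addable_killed q t s).
Implicit Types (D U : seq (node m)) (x y : node m) (h g : A).

Lemma addable_poly_neq0 D x (e : int) : stacked D -> corner D x ->
  `|e|%N = 1%N -> ((size D).+1 < n)%N -> (addable_poly q D).[res x + e%:~R] != 0.
Proof.
move=> sD cx e1 szD; rewrite horner_prod prodf_seq_neq0; apply/allP => y.
rewrite addable_nodesE // hornerXsubC => cy /=; have [->|xy] := eqVneq x y.
  rewrite addrAC subrr add0r; apply: (proj1 gen); lia.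
have := residue_sep (e := - e) gen sD cx cy xy; rewrite abszN e1 => /(_ isT).
by rewrite addn1 => /(_ szD); congr (_ != 0); rewrite rmorphN; ring.
Qed.

(** The weight (U, res x, res x + e), whose last entry is the residue of a removable node y
    of U, does not occur.  As long as y is not the last node of U, an invertible intertwiner
    exchanges it with the next one.  When it is, the last three eigenvalues are a + e, a,
    a + e; exchanging the first two, or the last two, would give an eigenvalue one off an
    addable residue, so both intertwiners vanish.  Thus s_N acts by -e and s_(N+1) by e, and
    the braid relation gives h = 0. *)
Lemma excluded_weight U2 U0 x y (e : int) h : let U := U2 ++ y :: U0 in
  stacked U -> removable U y -> corner U x -> `|e|%N = 1%N -> res y = res x + e%:~R ->
  (size U + 2 <= n)%N -> (forall j, (j <= size U)%N -> addable_killed j) ->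
  weight (x :: U) h -> J (size U).+2 * h = (res x + e%:~R) *: h -> h = 0.
Proof.
elim/last_ind: U2 U0 h => [|U2 z IH] U0 h /=; last first.
  rewrite cat_rcons => sU ry cx e1 yx szU Bk [Jx w] Jh.
  have [sU' cy cz yz] := stacked_swap ry sU.
  set h' := intertwine s (size U0).+1 (res y) (res z) h.
  have UU' : U2 ++ z :: y :: U0 =i U2 ++ y :: z :: U0.
    by move=> v; rewrite !mem_cat !inE; congr (_ || _); rewrite orbCA.
  have szE : size (U2 ++ y :: z :: U0) = size (U2 ++ z :: y :: U0) by rewrite !size_cat.
  have sJ : GRing.comm (s (size U0).+1) (J (size (U2 ++ z :: y :: U0)).+2).
    by apply: (jm_comm_s_below rel) => //; move: szU; rewrite size_cat /=; lia.
  have h'0 : h' = 0.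
    apply: (IH (z :: U0)) => //.
    - by rewrite -(eq_removable UU').
    - by rewrite -(eq_corner UU').
    - by rewrite szE.
    - by rewrite szE.
    - have := @weight_swap _ _ _ _ _ _ _ rel (x :: U2) U0 y z h.
      by apply; rewrite /= ?szE //; lia.
    - rewrite szE /h' /intertwine mulrDr -scalerAr mulrA -sJ -mulrA Jh.
      by rewrite scalerDr -scalerAr !scalerA mulrC.
  have [Jz [Jy _]] := weight_cat w.
  have szU0 : ((size U0).+1 < n)%N by move: szU; rewrite size_cat /=; lia.
  have [|_ _] := intertwineP rel _ Jy Jz; first exact: szU0.
  rewrite -/h' h'0 /intertwine mulr0 scaler0 addr0 => /esym/eqP.
  rewrite scaler_eq0 => /orP[|/eqP //].
  have -> : 1 - (res y - res z) ^+ 2 = - ((res y - res z - 1%:~R) * (res y - res z - (-1)%:~R)).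
    by rewrite rmorphN /= mulr1z; ring.
  have s0 := stacked_cat sU; have {}s0 : stacked U0 by case/and3P: s0.
  by rewrite oppr_eq0 mulf_eq0 !(negbTE (residue_sep gen s0 cy cz yz _ _)) //= addn1.
move=> /[dup] sU /andP[cy sU0] ry cx e1 yx szU Bk [Jx [Jy w0]] Jh.
have szU0 : ((size U0).+1 < n)%N by lia.
have szU1 : ((size U0).+2 < n)%N by lia.
have eE : e%:~R * e%:~R = 1 :> K.
  rewrite -rmorphM -[1]/(1%:~R); congr (_%:~R); move: e1; case: (intP e) => // k /= [->] //.
have e0 : e%:~R != 0 :> K by apply: (proj1 gen); lia.
have xy : res x = res y + (- e)%:~R by rewrite yx rmorphN addrK.
set k := (size U0).+1 in szU0 szU1 Jx Jy Jh *.
(* res x is one off the addable residue res y, hence not a residue addable to U0 *)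
have sh : s k * h = - (e%:~R *: h).
  suff: intertwine s k (res y) (res x) h = 0.
    rewrite /intertwine yx addrAC subrr add0r => /(congr1 ( *:%R (e%:~R))).
    by rewrite scaler0 scalerDr scalerA eE scale1r => /eqP; rewrite addr_eq0 => /eqP.
  have [||Jh1 w1] := @weight_swap _ _ _ _ _ _ _ rel [::] U0 y x h; [by rewrite /=; lia | by [] |].
  case: w1 => J1 w1. apply: (weight_support gen sU0 _ _ w1 J1) => //.
  - by rewrite ltnW.
  - by apply: Bk => /=.
  - by rewrite xy; apply: addable_poly_neq0 => //; rewrite abszN.
(* res x + e is one off the addable residue res x, hence not a residue addable to U *)
have sh1 : s k.+1 * h = e%:~R *: h.
  have [|J1 _ _] := intertwineP rel _ Jx Jh; first by rewrite szU1.
  set h' := intertwine _ _ _ _ _ in J1.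
  suff: h' = 0.
    rewrite /h' /intertwine opprD addNKr => /(congr1 ( *:%R (e%:~R))).
    rewrite scaler0 scalerDr scalerA mulrN eE scaleN1r => /eqP.
    by rewrite addrC subr_eq0 => /eqP.
  have wU : weight (y :: U0) h'.
    apply: weight_scale_add; [apply: weight_mull|] => // i iU.
    by apply/commr_sym/(jm_comm_s_above rel); rewrite /= in iU; lia.
  apply: (weight_support gen (sU : stacked (y :: U0)) _ _ wU J1) => //.
  - by apply: Bk.
  - exact: addable_poly_neq0.
have /(congr1 ( *%R^~ h)) := s_braid rel (ltn0Sn _ : (0 < k)%N) szU1.
rewrite -scaleNr in sh; rewrite -!mulrA !(sh, sh1, =^~ scalerAr) !scalerA => /eqP.
rewrite -subr_eq0 -scalerBl scaler_eq0 => /orP[|/eqP //].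
have two : 2%:~R != 0 :> K by apply: (proj1 gen); lia.
set c : K := _ - _; have -> : c = e%:~R * e%:~R * e%:~R * 2%:~R by rewrite /c; ring.
by rewrite !mulf_eq0 (negbTE e0) (negbTE two).
Qed.

End Spectrum.

Section SpectrumStep.
Variables (K : fieldType) (m n : nat) (q : 'I_m -> K).
Variables (A : algType K) (t : A) (s : nat -> A).
Hypothesis rel : forall x y, hecke_rel n q t s x y -> x = y.
Hypothesis gen : generic n q.

Local Notation J := (jucys_murphy t s).
Local Notation res := (residue q).
Local Notation E := (stack_idempotent q t s).
Local Notation weight := (weight q t s).
Local Notation addable_killed := (addable_killed q t s).
Implicit Types (D U : seq (node m)) (x y : node m) (h g : A).

Lemma addable_poly_nil : addable_poly q [::] = \prod_(c < m) ('X - (q c)%:P).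
Proof.
rewrite /addable_poly (perm_big [seq (1, 1, c)%N | c <- enum 'I_m]) /=.
  by rewrite big_map enumT; apply: eq_bigr => c _; rewrite /residue subrr add0r.
apply: uniq_perm; first exact: addable_nodes_uniq.
  by rewrite map_inj_uniq ?enum_uniq // => c c' [].
move=> [[a b] c]; rewrite addable_nodesE //= !in_nil !orbF.
apply/idP/mapP => [|[c' _ [-> -> _]] //].
case/and4P => _ _ /eqP-> /eqP->.
by exists c; rewrite ?mem_enum.
Qed.

Lemma addable_killed0 : addable_killed 0.
Proof.
case=> // _ _; rewrite mulr1 addable_poly_nil rmorph_prod /=.
rewrite -(rel (HeckeCyclotomic n q t s)); apply: eq_bigr => c _.
by rewrite rmorphB /= horner_algX horner_algC.
Qed.

Definition right_of x : node m := let: (a, b, c) := x in (a, b.+1, c).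
Definition below x : node m := let: (a, b, c) := x in (a.+1, b, c).

Lemma residue_right x : res (right_of x) = res x + 1.
Proof. by case: x => [[a b] c] /=; rewrite -addn1 PoszD !rmorphB rmorphD /=; ring. Qed.

Lemma residue_below x : res (below x) = res x - 1.
Proof. by case: x => [[a b] c] /=; rewrite -addn1 PoszD !rmorphB rmorphD /=; ring. Qed.

(** If the right neighbour of the last node x is not addable, it lacks its upper neighbour;
    so the node above x ends its row, and it was removable before x was stacked below it. *)
Lemma right_blocked D x : stacked (x :: D) -> ~~ corner (x :: D) (right_of x) ->
  exists2 y, (y \in D) && removable D y & x = below y.
Proof.
case: x => [[i j] c] /= /andP[/and5P[i0 j0 nD u _] sD].
have nR : (i, j.+1, c) \notin D.
  by apply: contra nD => R; apply: mem_le sD R _ _; rewrite ?i0 ?j0 ?leqnn ?leqnSn.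
rewrite i0 !inE eqxx orbT andbT !negb_or nR !xpair_eqE eqxx /=.
have -> : (j.+1 == j) = false by lia.
rewrite /= andbF orFb negb_or => /andP[i1 nU].
have iE : (i.-1).+1 = i by rewrite prednK.
exists (i.-1, j, c); last by rewrite /= iE.
by rewrite (negbTE i1) /= in u; rewrite u /= iE nU nD.
Qed.

Lemma below_blocked D x : stacked (x :: D) -> ~~ corner (x :: D) (below x) ->
  exists2 y, (y \in D) && removable D y & x = right_of y.
Proof.
case: x => [[i j] c] /= /andP[/and5P[i0 j0 nD _ l] sD].
have nR : (i.+1, j, c) \notin D.
  by apply: contra nD => R; apply: mem_le sD R _ _; rewrite ?i0 ?j0 ?leqnn ?leqnSn.
rewrite j0 !inE eqxx orbT /= !negb_or nR !xpair_eqE eqxx /=.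
have -> : (i.+1 == i) = false by lia.
rewrite /= ?orFb negb_or => /andP[j1 nL].
have jE : (j.-1).+1 = j by rewrite prednK.
exists (i, j.-1, c); last by rewrite /= jE.
by rewrite (negbTE j1) /= in l; rewrite l /= jE nL nD.
Qed.

Lemma excluded_stack D x y (e : int) h : stacked (x :: D) -> (y \in D) && removable D y ->
  `|e|%N = 1%N -> res y = res x + e%:~R -> (size D + 2 <= n)%N ->
  (forall j, (j <= size D)%N -> addable_killed j) ->
  weight (x :: D) h -> J (size D).+2 * h = (res x + e%:~R) *: h -> h = 0.
Proof.
move=> /= /andP[cx sD] /andP[yD ry] e1 yx szD Bk; case/splitPr: yD cx sD ry szD Bk => U2 U0 *.
by apply: (@excluded_weight _ _ _ _ _ _ _ rel gen U2 U0 x y e).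
Qed.

Lemma kill_factor D h k (p : {poly K}) (b : K) : weight D h -> GRing.comm (J k) h ->
  (forall g, weight D g -> J k * g = b *: g -> g = 0) ->
  h * horner_alg (J k) (p * ('X - b%:P)) = 0 -> h * horner_alg (J k) p = 0.
Proof.
move=> wh Jh excl p0; apply: excl; first exact: weight_mulr.
apply/eqP; rewrite -subr_eq0 -mulr_algl -mulrBl mulrA; apply/eqP; rewrite -{}p0.
rewrite [p * _]mulrC rmorphM /= rmorphB /= horner_algX horner_algC mulrA; congr (_ * _).
by rewrite mulrBl mulrBr Jh mulr_algl mulr_algr.
Qed.

Lemma addable_poly_sub D (l : seq (node m)) : uniq l -> {subset l <= addable_nodes D} ->
  exists p, addable_poly q D = (\prod_(y <- l) ('X - (res y)%:P)) * p.
Proof.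
move=> ul lD; exists (\prod_(y <- addable_nodes D | y \notin l) ('X - (res y)%:P)).
rewrite /addable_poly (bigID (mem l)) /=; congr (_ * _).
rewrite -big_filter; apply: perm_big; apply: uniq_perm => //.
  by rewrite filter_uniq ?addable_nodes_uniq.
by move=> y; rewrite mem_filter andb_idr // => /lD.
Qed.

(** Let a = res x for the last node x, X = J_(k+1), Y = J_(k+2), and let Q be the product
    over the nodes other than x that are addable before x.  The vector u below satisfies
    X u = u Y, so evaluating the annihilating polynomial of X on it yields a relation for Y,
    ((Y - a)^2 - 1) Q(Y) e = 0.  The roots a + 1 and a - 1 are the residues of the right and
    lower neighbours of x and survive only if these are addable. *)
Lemma addable_killed_step k : (k.+1 < n)%N -> (forall j, (j <= k)%N -> addable_killed j) ->
  addable_killed k.+1.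
Proof.
move=> kn Bk [//|x D] /[dup] sxD /andP[cx sD] [szD].
have k0n : (0 < k.+1 < n)%N by [].
move eE: (E (x :: D)) => e; set X := J k.+1; set Y := J k.+2; set a := res x.
have [we wDe] : weight (x :: D) e.
  rewrite -eE; apply: (weight_stack_idempotent rel sxD) => /= [|j]; rewrite szD; first exact: ltnW.
  by rewrite ltnS; apply: Bk.
have wxD : weight (x :: D) e by [].
rewrite /= szD -/X -/a in we.
have eY : GRing.comm Y e by rewrite -eE; apply: (stack_idempotent_jm rel) => /=; lia.
have sY := s_jm rel k0n; have ys := jm_s rel k0n; have ss := s_invol rel k0n.
rewrite -/X -/Y in sY ys.
have Ee : E D * e = e by apply: (stack_idempotent_weight gen sD) => //; lia.
set Q := addable_poly_but q D x.
pose v := Y * e - a *: e; pose u := s k.+1 * v - e.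
have vY : v * Y = Y * v by rewrite /v mulrBl mulrBr -mulrA -eY -scalerAl -scalerAr eY.
have Xs : X * s k.+1 = s k.+1 * Y - 1 by rewrite sY addrK.
have Xu : X * u = u * Y.
  rewrite /u mulrBr mulrBl -[_ * v * Y]mulrA vY -eY [X * (_ * _)]mulrA Xs mulrBl mul1r we.
  by rewrite {2}/v opprB -!mulrA -!addrA; congr (_ + _); rewrite addrC subrK.
have su : (X - a%:A) * (s k.+1 * e) = u.
  rewrite mulrBl mulrA Xs mulrBl mul1r -mulrA mulr_algl /u /v mulrBr -scalerAr.
  by rewrite addrAC.
have Ps : horner_alg X (addable_poly q D) * (s k.+1 * e) = 0.
  have sE : GRing.comm (s k.+1) (E D).
    apply: stack_idempotent_comm => i; rewrite szD => ik.
    by apply/commr_sym/(jm_comm_s_above rel); lia.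
  have -> : s k.+1 * e = E D * (s k.+1 * e) by rewrite -{1}Ee mulrA sE -mulrA.
  rewrite [LHS]mulrA; by have := Bk k (leqnn k) D sD szD; rewrite -/X => ->; rewrite mul0r.
have vE : (Y - a%:A) * e = v by rewrite mulrBl mulr_algl.
set w := e * horner_alg Y Q.
have wfix : s k.+1 * ((Y - a%:A) * w) = w.
  move: Ps; rewrite (addable_polyE q sD cx) mulrC rmorphM /= -mulrA rmorphB /=.
  rewrite horner_algX horner_algC su (horner_alg_intertwine _ Xu) /u -vE mulrBl -!mulrA.
  by move/eqP; rewrite subr_eq0 => /eqP.
have w1 : (Y - a%:A) * w = s k.+1 * w by rewrite -{2}wfix mulrA ss mul1r.
have w2 : (Y - a%:A) * ((Y - a%:A) * w) = w.
  rewrite w1 mulrA mulrBl ys mulrBl mulrDl mul1r -!mulrA [X * w]mulrA we.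
  by rewrite -scalerAl -scalerAr mulr_algl addrAC subrr add0r.
have w3 : e * horner_alg Y (Q * ('X - (res (right_of x))%:P) * ('X - (res (below x))%:P)) = 0.
  have eQ : horner_alg Y ('X - (a + 1)%:P) * (horner_alg Y ('X - (a - 1)%:P) * w) = 0.
    rewrite mulrA -rmorphM /=; have -> : ('X - (a + 1)%:P) * ('X - (a - 1)%:P) =
        ('X - a%:P) * ('X - a%:P) - 1 :> {poly K}.
      by rewrite polyCD polyCB; ring.
    rewrite rmorphB rmorphM rmorphB /= horner_algX horner_algC rmorph1.
    by rewrite mulrBl mul1r -mulrA w2 subrr.
  have YE p : horner_alg Y p * e = e * horner_alg Y p.
    exact/commr_sym/horner_alg_comm/commr_sym.
  rewrite -residue_right -residue_below in eQ; rewrite -[RHS]eQ /w.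
  rewrite [RHS]mulrA -rmorphM /= [RHS]mulrA YE -[RHS]mulrA -rmorphM /=.
  by rewrite [_ * Q]mulrC mulrA.
have excl y (c : int) : (y \in D) && removable D y -> `|c|%N = 1%N -> res y = a + c%:~R ->
    forall g, weight (x :: D) g -> Y * g = (a + c%:~R) *: g -> g = 0.
  move=> yD c1 yx g wg; have := @excluded_stack D x y c g sxD yD c1 yx.
  by rewrite szD; apply => //; lia.
have exclR : ~~ corner (x :: D) (right_of x) ->
    forall g, weight (x :: D) g -> Y * g = res (right_of x) *: g -> g = 0.
  case/(right_blocked sxD) => y yD xE; rewrite residue_right -[1]/(1%:~R).
  by apply: excl yD _ _ => //; rewrite /a xE residue_below subrK.
have exclB : ~~ corner (x :: D) (below x) ->
    forall g, weight (x :: D) g -> Y * g = res (below x) *: g -> g = 0.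
  case/(below_blocked sxD) => y yD xE; rewrite residue_below -[-1]/((-1)%:~R).
  by apply: excl yD _ _ => //; rewrite /a xE residue_right rmorphN addrK.
pose near := [seq y <- [:: right_of x; below x] | corner (x :: D) y].
have w4 : e * horner_alg Y (Q * \prod_(y <- near) ('X - (res y)%:P)) = 0.
  have kill p b := @kill_factor _ _ _ p b wxD eY.
  have {}w3 : e * horner_alg Y (Q * (if corner (x :: D) (right_of x) then
      'X - (res (right_of x))%:P else 1) * ('X - (res (below x))%:P)) = 0.
    case: ifP => [//|/negbT/exclR nR]; apply: (kill _ _ nR).
    by rewrite mulr1 mulrAC.
  move: w3; rewrite /near /=.
  case: (boolP (corner (x :: D) (below x))) => [_|/exclB nB w3]; last first.
    by move: (kill _ _ nB w3); case: ifP => _; rewrite ?big_cons ?big_nil ?mulr1.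
  by case: ifP => _; rewrite !big_cons ?big_nil ?mulr1 ?mulrA.
have near_uniq : uniq near.
  rewrite filter_uniq //= andbT inE; case: (x) => [[a1 b1] c1] /=.
  by rewrite !xpair_eqE; lia.
have [p ->] : exists p, addable_poly q (x :: D) =
    (\prod_(y <- [seq y <- addable_nodes D | y != x] ++ near) ('X - (res y)%:P)) * p.
  apply: addable_poly_sub.
    rewrite cat_uniq near_uniq filter_uniq ?addable_nodes_uniq // andbT /=.
    apply/hasPn => y; rewrite mem_filter => /andP[_ yx].
    rewrite mem_filter addable_nodesE // negb_and; apply/orP; right.
    move: yx cx; rewrite !inE; case: (x) => [[a1 b1] c1] /=.
    by case/orP => /eqP-> /= /and5P[a10 b10 /negbTE-> _ _]; rewrite ?orbF; lia.
  move=> y; rewrite mem_cat [y \in addable_nodes _]addable_nodesE //.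
  case/orP; rewrite mem_filter => /andP[//]; rewrite addable_nodesE // => yx cy.
  exact: corner_push.
rewrite big_cat big_filter /= -/(addable_poly_but q D x) -/Q.
rewrite (commr_sym (horner_alg_comm _ (commr_sym eY))) rmorphM /= mulrA.
by rewrite [X in X * _]w4 mul0r.
Qed.

Theorem addable_killedP k : (k < n)%N -> addable_killed k.
Proof.
elim/ltn_ind: k => -[_ _|k IH kn]; first exact: addable_killed0.
by apply: addable_killed_step => // j jk; apply: IH => //; lia.
Qed.

End SpectrumStep.

(** * The fusion factors with one free variable *)

Section CentralPolynomials.
Variables (K : fieldType) (A : algType K).

(** The embedding of K[z] into the centre of A[z]. *)
Definition central_poly (p : {poly K}) : {poly A} := map_poly (in_alg A) p.

HB.instance Definition _ := GRing.RMorphism.copy central_poly (map_poly (in_alg A)).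

Lemma central_polyX : central_poly 'X = 'X. Proof. exact: map_polyX. Qed.

Lemma central_polyC c : central_poly c%:P = (c%:A)%:P.
Proof. by rewrite [LHS](map_polyC (in_alg A)). Qed.

Lemma algC_comm (c : K) (P : {poly A}) : GRing.comm P (c%:A)%:P.
Proof. by apply/polyP => k; rewrite coefCM coefMC mulr_algl mulr_algr. Qed.

Lemma central_polyP (p : {poly K}) (P : {poly A}) : GRing.comm P (central_poly p).
Proof.
elim/poly_ind: p => [|p c IH]; first by rewrite rmorph0; exact: commr0.
rewrite rmorphD rmorphM /= central_polyX central_polyC; apply: commrD; last exact: algC_comm.
by apply: commrM => //; exact: commr_polyX.
Qed.

Lemma horner_central p (c : K) : (central_poly p).[c%:A] = (p.[c])%:A.
Proof. exact: (horner_map (in_alg A)). Qed.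

Lemma comm_poly_alg (P : {poly A}) (c : K) : comm_poly P c%:A.
Proof. by rewrite /comm_poly mulr_algl mulr_algr. Qed.

Lemma horner_algM (P Q : {poly A}) (c : K) : (P * Q).[c%:A] = P.[c%:A] * Q.[c%:A].
Proof. by rewrite hornerM_comm //; exact: comm_poly_alg. Qed.

Lemma central_poly_lreg p : p \is monic -> GRing.lreg (central_poly p).
Proof. by move=> pm; apply/monic_lreg; rewrite map_monic. Qed.

(** Factor theorem for a central polynomial at a non-central point of the algebra. *)
Lemma central_poly_factor (a : A) (p : {poly K}) :
  exists S, central_poly p - (horner_alg a p)%:P = ('X - a%:P) * S.
Proof.
elim/poly_ind: p => [|p c [S IH]]; first by exists 0; rewrite !rmorph0 mulr0 subrr.
exists (S * 'X + (horner_alg a p)%:P).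
rewrite !rmorphD !rmorphM /= central_polyX central_polyC horner_algX horner_algC.
rewrite opprD addrACA subrr addr0 mulrDr mulrA -IH mulrBl -addrA; congr (_ + _).
rewrite mulrBl [_ * 'X]commr_polyX addKr -!polyCM.
by rewrite (commr_sym (horner_alg_comm p (erefl : GRing.comm a a))).
Qed.

End CentralPolynomials.

(** The numerator of phi_k once the denominators z - z_1, .., z - z_(k-1) are cleared, over
    any ring: it is used both with one free variable and with all of them, and ring morphisms
    relate the two. *)
Fixpoint phi_num (B : pzRingType) (z tz : B) (w b : nat -> B) (k : nat) : B :=
  match k with
  | 0 => 1
  | 1 => tz
  | k'.+1 => (1 + (z - w k') * b k') * phi_num z tz w b k' * b k'
  end.

Fixpoint stack_upto (m : nat) (x : nat -> node m) (k : nat) : seq (node m) :=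
  if k is k'.+1 then x k :: stack_upto x k' else [::].

Lemma stack_uptoS m (x : nat -> node m) k : stack_upto x k.+1 = x k.+1 :: stack_upto x k.
Proof. by []. Qed.

Lemma size_stack_upto m (x : nat -> node m) k : size (stack_upto x k) = k.
Proof. by elim: k => //= k ->. Qed.

Lemma stack_idempotent_cons (K : fieldType) m (q : 'I_m -> K) (A : algType K) (t : A) s x D :
  stack_idempotent q t s (x :: D) =
  stack_idempotent q t s D * ((addable_poly_but q D x).[residue q x]^-1 *:
    horner_alg (jucys_murphy t s (size D).+1) (addable_poly_but q D x)).
Proof. by []. Qed.

Local Arguments stack_idempotent : simpl never.
Local Arguments stack_upto : simpl never.

Section FusionKey.
Variables (K : fieldType) (m n : nat) (q : 'I_m -> K).
Variables (A : algType K) (t : A) (s : nat -> A).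
Hypothesis rel : forall x y, hecke_rel n q t s x y -> x = y.
Hypothesis gen : generic n q.
Variable x : nat -> node m.
Hypothesis sx : stacked (stack_upto x n).

Local Notation J := (jucys_murphy t s).
Local Notation res := (residue q).
Local Notation D := (stack_upto x).
Local Notation E k := (stack_idempotent q t s (D k)).
Local Notation lift := (@central_poly K A).

(** phi_k(c_1, .., c_(k-1); z) times the product of the z - c_i, where the c_i are the
    residues of the nodes x_i. *)
Definition phi_poly (k : nat) : {poly A} :=
  phi_num 'X (baxter_t q t) (fun i => (res (x i))%:A%:P) (fun i => (s i)%:P) k.

Definition phi_den (k : nat) : {poly K} := \prod_(y <- D k) ('X - (res y)%:P).

Definition phi_factor (k : nat) : {poly K} :=
  \prod_(c < m) ('X - (q c)%:P) * \prod_(y <- D k) (('X - (res y)%:P) ^+ 2 - 1).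

Lemma stacked_upto k : (k <= n)%N -> stacked (D k).
Proof.
move=> /subnK; rewrite addnC => nE; move: sx; rewrite -{}nE.
by elim: (n - k)%N => [|j IH]; rewrite ?addn0 // addnS => /andP[_ /IH].
Qed.

Lemma weight_upto k : (k <= n)%N -> weight q t s (D k) (E k).
Proof.
move=> kn; apply: (weight_stack_idempotent rel); rewrite ?stacked_upto ?size_stack_upto //.
by move=> j jk; apply: (addable_killedP rel gen); exact: leq_trans jk kn.
Qed.

(** The idempotents of the successive shapes form a decreasing chain. *)
Lemma idempotent_absorb k : (k.+1 <= n)%N -> E k * E k.+1 = E k.+1.
Proof.
move=> kn; have [_ w] := weight_upto kn.
have sD := stacked_upto (ltnW kn).
by apply: (stack_idempotent_weight gen sD _ w); rewrite size_stack_upto ltnW.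
Qed.

Lemma jm_idempotent k : (k < n)%N -> J k.+1 * E k.+1 = res (x k.+1) *: E k.+1.
Proof.
move=> kn; have [je _] := weight_upto kn.
by move: je; rewrite -[size _]/(size (D k.+1)) size_stack_upto.
Qed.

Lemma idempotent_jm k : (k <= n)%N -> forall i, (0 < i <= n)%N -> GRing.comm (J i) (E k).
Proof. by move=> kn i iN; apply: (stack_idempotent_jm rel); rewrite ?size_stack_upto. Qed.

(** The recursion t_k (z - J_(k+1)) = (z - J_k) t_k - 1, with denominators cleared. *)
Lemma phi_poly_jm k : (k < n)%N ->
  phi_poly k.+1 * ('X - (J k.+1)%:P) * (E k)%:P * lift (phi_den k) =
  lift (phi_factor k) * (E k)%:P.
Proof.
elim: k => [_|k IH kn].
  rewrite /phi_poly /= /phi_den /phi_factor !big_nil !(rmorph1, mulr1).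
  rewrite baxter_tK ?(rel (HeckeCyclotomic n q t s)) // rmorph_prod /=.
  by apply: eq_bigr => c _; rewrite rmorphB /= central_polyX central_polyC.
have {}IH := IH (ltnW kn); set M := phi_poly k.+1 in IH.
set e0 := E k in IH; set e := E k.+1.
set sg := (s k.+1)%:P; pose l := 'X - (res (x k.+1))%:P.
have lE : lift l = 'X - (res (x k.+1))%:A%:P.
  by rewrite rmorphB /= central_polyX central_polyC.
have MS : phi_poly k.+2 = (1 + lift l * sg) * M * sg by rewrite lE.
have denS : phi_den k.+1 = l * phi_den k by rewrite /phi_den big_cons.
have facS : phi_factor k.+1 = (l * l - 1) * phi_factor k.
  by rewrite /phi_factor big_cons mulrCA mulrC.
have e0e : e0%:P * e%:P = e%:P by rewrite -polyCM idempotent_absorb // ltnW.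
have se0 : sg * e0%:P = e0%:P * sg.
  rewrite -!polyCM; congr (_%:P); apply: stack_idempotent_comm => i; rewrite size_stack_upto => ik.
  by apply/commr_sym/(jm_comm_s_above rel); lia.
have k1n : (0 < k.+1 < n)%N by [].
have sJ : sg * ('X - (J k.+2)%:P) = ('X - (J k.+1)%:P) * sg - 1.
  rewrite mulrBr mulrBl -polyCM (s_jm rel k1n) polyCD polyCM opprD addrA.
  by rewrite commr_polyX.
have Je : ('X - (J k.+1)%:P) * e%:P = lift l * e%:P.
  by rewrite lE !mulrBl -!polyCM jm_idempotent ?mulr_algl // ltnW.
clearbody e e0 M.
have cP p P : lift p * P = P * lift p by rewrite (central_polyP p P).
have ss : sg * sg = 1 by rewrite -polyCM (s_invol rel k1n).
have IHr P : M * ('X - (J k.+1)%:P) * (e0%:P * P) * lift (phi_den k) =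
    lift (phi_factor k) * (e0%:P * P).
  by rewrite mulrA -[_ * P * _]mulrA -(cP _ P) mulrA IH -mulrA.
have e0sg : e0%:P * (sg * e%:P) = sg * e%:P by rewrite mulrA -se0 -mulrA e0e.
have H2 := IHr (sg * e%:P); rewrite e0sg in H2.
have H3 : M * e%:P * lift l * lift (phi_den k) = lift (phi_factor k) * e%:P.
  by rewrite -[M * _ * _]mulrA -(cP l) -Je mulrA -{1}e0e IHr e0e.
have H1 : M * sg * ('X - (J k.+2)%:P) * e%:P * lift (phi_den k.+1) =
    lift (phi_factor k) * (lift l * sg - 1) * e%:P.
  have -> : M * sg * ('X - (J k.+2)%:P) = M * ('X - (J k.+1)%:P) * sg - M.
    by rewrite -[LHS]mulrA sJ mulrBr mulr1 mulrA.
  rewrite denS rmorphM /= [LHS]mulrA !mulrBl H3 [in RHS]mulrBr mulr1 [RHS]mulrBl; congr (_ - _).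
  rewrite -[_ * sg * _]mulrA -[LHS]mulrA (cP l (lift _)) [LHS]mulrA H2.
  by rewrite -[LHS]mulrA -(cP l) !mulrA.
have lL : lift (l * l - 1) = (1 + lift l * sg) * (lift l * sg - 1).
  rewrite rmorphB rmorphM rmorph1 mulrDl mul1r mulrBr mulr1 [RHS]addrC addrA subrK; congr (_ - _).
  by rewrite -mulrA (mulrA sg) -(cP l sg) -(mulrA (lift l)) ss mulr1.
transitivity ((1 + lift l * sg) * (M * sg * ('X - (J k.+2)%:P) * e%:P * lift (phi_den k.+1))).
  by rewrite MS !mulrA.
have -> : lift (phi_factor k.+1) = lift (l * l - 1) * lift (phi_factor k).
  by rewrite facS rmorphM.
rewrite H1 lL !mulrA; congr (_ * _).
by rewrite -(cP (phi_factor k) (1 + _)) -!mulrA (cP (phi_factor k)) !mulrA.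
Qed.

Lemma phi_den_monic k : phi_den k \is monic.
Proof. by apply: monic_prod => y _; exact: monicXsubC. Qed.

(** Here N and Da stand for a reduced form of the scalar in [phi_poly_jm], with the zero of
    its numerator at the residue c of the new node split off.  With P = (z - c) P', the
    polynomial S = P'(J) + (z - c) (P'(z) - P'(J)) / (z - J) satisfies
    (z - J) S = P(z) - P(J); the factor z - c then cancels on both sides, and S takes the
    value P'(J) at c. *)
Lemma phi_poly_regular k (N Da : {poly K}) : (k < n)%N ->
  ('X - (res (x k.+1))%:P) * N * phi_den k ^+ 2 = Da * phi_factor k ->
  exists2 S, phi_poly k.+1 * (E k)%:P * lift (addable_poly_but q (D k) (x k.+1) * Da) =
             lift (N * phi_den k) * ((E k)%:P * S)
    & S.[(res (x k.+1))%:A] = horner_alg (J k.+1) (addable_poly_but q (D k) (x k.+1)).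
Proof.
move=> kn NDa; set P' := addable_poly_but q _ _; set l := 'X - _ in NDa.
have sD := stacked_upto (ltnW kn).
have cx : corner (D k) (x k.+1) by have /andP[] := stacked_upto kn.
have cP p P : lift p * P = P * lift p by rewrite (central_polyP p P).
have [S' S'E] := central_poly_factor (J k.+1) P'.
have lE : lift l = 'X - (res (x k.+1))%:A%:P.
  by rewrite rmorphB /= central_polyX central_polyC.
exists ((horner_alg (J k.+1) P')%:P + lift l * S'); last first.
  rewrite hornerD hornerC horner_algM lE hornerXsubC subrr mul0r addr0 //.
set S := _ + _; pose XJ : {poly A} := 'X - (J k.+1)%:P.
have PE : addable_poly q (D k) = l * P' by exact: addable_polyE.
have XS : XJ * S = lift (l * P') - (horner_alg (J k.+1) (l * P'))%:P.
  have -> : horner_alg (J k.+1) (l * P') =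
      (J k.+1 - (res (x k.+1))%:A) * horner_alg (J k.+1) P'.
    by rewrite rmorphM rmorphB /= horner_algX horner_algC.
  have -> : lift (l * P') = lift l * lift P' by rewrite rmorphM.
  rewrite /S mulrDr mulrA -(cP l XJ) -[_ * _ * S']mulrA -S'E mulrBr polyCM polyCB addrCA.
  congr (_ + _); rewrite -mulrBl -mulNr lE /XJ !opprB; congr (_ * _).
  by rewrite addrC addrA subrK.
have ePJ : (E k)%:P * (horner_alg (J k.+1) (l * P'))%:P = 0 :> {poly A}.
  rewrite -polyCM -PE.
  have Je : GRing.comm (E k) (J k.+1) by apply/commr_sym/idempotent_jm => //; exact: ltnW.
  by rewrite (horner_alg_comm _ Je) (addable_killedP rel gen kn) ?size_stack_upto.
have key := phi_poly_jm kn; move: (E k) (idempotent_jm (ltnW kn)) ePJ key => e eJ ePJ key.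
have eXJ : XJ * e%:P = e%:P * XJ.
  by rewrite mulrBl mulrBr -!polyCM eJ ?commr_polyX //; lia.
have eXS : XJ * e%:P * S = lift (l * P') * e%:P.
  by rewrite eXJ -mulrA XS mulrBr ePJ subr0 -cP.
have reg : GRing.lreg (lift (l * phi_den k)).
  by apply: central_poly_lreg; rewrite rpredM ?monicXsubC ?phi_den_monic.
have main : phi_poly k.+1 * e%:P * lift (l * P' * phi_den k) = lift (phi_factor k) * (e%:P * S).
  rewrite [RHS]mulrA -key -/XJ -[RHS]mulrA cP mulrA -[_ * XJ * _]mulrA -[_ * (XJ * _) * _]mulrA eXS.
  have -> : lift (l * P' * phi_den k) = lift (l * P') * lift (phi_den k) by rewrite rmorphM.
  by rewrite (cP (l * P') e%:P) !mulrA.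
apply: reg.
transitivity (phi_poly k.+1 * e%:P * lift (l * P' * phi_den k) * lift Da).
  by rewrite cP -!mulrA -!rmorphM; congr (_ * (_ * lift _)); ring.
rewrite main -cP !mulrA; congr (_ * _ * _); rewrite -!rmorphM -NDa; congr (lift _); ring.
Qed.

End FusionKey.

(** * Rows, columns and hooks *)

Local Arguments row : simpl never.
Local Arguments col : simpl never.

Section StripProducts.
Variables (R : comNzRingType) (m : nat) (w : 'I_m -> R) (z : R).
Implicit Types (D : seq (node m)) (x y : node m) (c : 'I_m) (d : R).

(** Factors attached to a column j and to a row i of component c; with d = 1 the point
    z is measured from an addable end, with d = 0 from a removable one. *)
Definition col_factor D c d j : R := z - w c + (col D j c)%:R - j%:R + d.
Definition row_factor D c d i : R := w c + (row D i c)%:R - i%:R + d - z.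

Definition node_value y : R := y.1.2%:R - y.1.1%:R + w y.2.

(** The distance from z to the content w_c + r - p, where p is the length of column r + 1:
    the corner at which the rows and the columns retained in [strip] meet. *)
Definition corner_gap D c r : R := z - w c - r%:R + (col D r.+1 c)%:R.

(** The columns left of column r + 1 and the rows met by column r + 1 cut the rim of
    component c into pieces, each contributing one end of its own. *)
Definition strip D c r d : R :=
  \prod_(1 <= j < r.+1) col_factor D c d j *
  \prod_(1 <= i < (col D r.+1 c).+1) row_factor D c d i.

Lemma prod_update (s : seq nat) (F F' : nat -> R) i0 : uniq s -> i0 \in s ->
  (forall i, i != i0 -> F' i = F i) ->
  exists u, \prod_(i <- s) F i = F i0 * u /\ \prod_(i <- s) F' i = F' i0 * u.
Proof.
move=> us i0s FF'; exists (\prod_(i <- s | i != i0) F i).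
by rewrite !(bigD1_seq i0) //=; split=> //; congr (_ * _); apply: eq_bigr.
Qed.

(** Adding a node of content v multiplies the products over the nodes by (z - v)^2 and by
    (z - v)^2 - 1.  Of the other factors exactly one column factor or one row factor changes,
    or a new row enters while the gap is shifted, according to the column of the node. *)
Lemma strip_identity D c r : stacked D ->
  corner_gap D c r * strip D c r 1 * \prod_(y <- D | y.2 == c) (z - node_value y) ^+ 2 =
  (z - w c) * strip D c r 0 * \prod_(y <- D | y.2 == c) ((z - node_value y) ^+ 2 - 1).
Proof.
rewrite /strip /corner_gap.
elim: D => [_|[[i j] k] D IH].
  rewrite !big_nil !mulr1 /col /= addr0.
  elim: r => [|r IH]; first by rewrite !big_geq // subr0.
  rewrite !(big_nat_recr r.+1) //= [RHS]mulrA -IH /col_factor /col /= -[r.+1]addn1 natrD.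
  by ring.
move=> /= /andP[cx sD]; have {}IH := IH sD; rewrite !big_cons /=.
have rowE a : row ((i, j, k) :: D) a c = ((i == a) && (k == c) + row D a c)%N by [].
have colE b : col ((i, j, k) :: D) b c = ((j == b) && (k == c) + col D b c)%N by [].
have [kc|kc] := eqVneq k c; last first.
  have cE b : col ((i, j, k) :: D) b c = col D b c by rewrite colE (negbTE kc) andbF.
  rewrite cE.
  have cf d b : col_factor ((i, j, k) :: D) c d b = col_factor D c d b.
    by rewrite /col_factor cE.
  have rf d a : row_factor ((i, j, k) :: D) c d a = row_factor D c d a.
    by rewrite /row_factor rowE (negbTE kc) andbF.
  rewrite (eq_bigr _ (fun b _ => cf 1 b)) (eq_bigr _ (fun a _ => rf 1 a)).
  by rewrite (eq_bigr _ (fun b _ => cf 0 b)) (eq_bigr _ (fun a _ => rf 0 a)).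
subst k; set D' := (i, j, c) :: D.
have /and5P[i0 j0 nD _ lD] := cx.
have rE a : a != i -> row D' a c = row D a c by rewrite rowE eq_sym => /negbTE->.
have cE b : b != j -> col D' b c = col D b c by rewrite colE eq_sym => /negbTE->.
have rDi := row_corner sD cx; have cDj := col_corner sD cx.
have rD'i : row D' i c = j by rewrite rowE !eqxx rDi /=; lia.
have cD'j : col D' j c = i by rewrite colE !eqxx cDj /=; lia.
have cf d b : b != j -> col_factor D' c d b = col_factor D c d b.
  by move=> bj; rewrite /col_factor cE.
have rf d a : a != i -> row_factor D' c d a = row_factor D c d a.
  by move=> ai; rewrite /row_factor rE.
have iE : i%:R = i.-1%:R + 1 :> R by rewrite -[in LHS](prednK i0) -addn1 natrD.
have jE : j%:R = j.-1%:R + 1 :> R by rewrite -[in LHS](prednK j0) -addn1 natrD.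
have cfj d : col_factor D c d j = z - w c + i%:R - j%:R + d - 1.
  by rewrite /col_factor cDj iE; ring.
have cf'j d : col_factor D' c d j = z - w c + i%:R - j%:R + d.
  by rewrite /col_factor cD'j.
have rfi d : row_factor D c d i = w c + j%:R - i%:R + d - z - 1.
  by rewrite /row_factor rDi jE; ring.
have rf'i d : row_factor D' c d i = w c + j%:R - i%:R + d - z.
  by rewrite /row_factor rD'i.
set v := node_value (i, j, c); have vE : v = j%:R - i%:R + w c by [].
set S2 := \prod_(y <- D | _) _ in IH *; set S1 := \prod_(y <- D | _) (_ - 1) in IH *.
have range d r' : (r' < j)%N -> \prod_(1 <= b < r'.+1) col_factor D' c d b =
    \prod_(1 <= b < r'.+1) col_factor D c d b.
  move=> rj; apply: eq_big_nat => b /andP[_ br]; apply: cf; lia.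
have range' d p : (p < i)%N -> \prod_(1 <= a < p.+1) row_factor D' c d a =
    \prod_(1 <= a < p.+1) row_factor D c d a.
  move=> rj; apply: eq_big_nat => b /andP[_ br]; apply: rf; lia.
(* the new node lies in one of the first r columns, in column r + 1, or further to the right *)
have [jr|rj|jr] := ltngtP j r.+1.
- have cr : col D r.+1 c = col D' r.+1 c by rewrite cE //; lia.
  have pi : (col D' r.+1 c < i)%N.
    rewrite -cr ltnNge; apply: contra nD => pi.
    have: (i, r.+1, c) \in D by rewrite mem_col // i0 pi.
    by move=> /(mem_le sD); apply; lia.
  have jr1 : j \in index_iota 1 r.+1 by rewrite mem_index_iota j0.
  rewrite !range' // -cr.
  have [u1 [e1 e1']] := prod_update (iota_uniq _ _) jr1 (cf 1).
  have [u0 [e0 e0']] := prod_update (iota_uniq _ _) jr1 (cf 0).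
  rewrite e1 e0 !cfj in IH; rewrite e1' e0' !cf'j.
  move: IH; set W := z - w c; set gap := _ + _%:R.
  set rw1 := \prod_(1 <= i < _) row_factor D c 1 _.
  set rw0 := \prod_(1 <= i < _) row_factor D c 0 _.
  move/(congr1 ( *%R^~ ((z - v) * (z - v + 1)))) => IH.
  by apply: etrans (etrans _ IH) _; rewrite vE /W; ring.
- have pc : col D' r.+1 c = col D r.+1 c by rewrite cE //; lia.
  have pi : (i <= col D r.+1 c)%N.
    have: (i, r.+1, c) \in D.
      have j1 : (j == 1%N) = false by lia.
      by rewrite j1 /= in lD; apply: mem_le sD lD _ _; lia.
    by rewrite mem_col // => /and3P[].
  have ir1 : i \in index_iota 1 (col D r.+1 c).+1 by rewrite mem_index_iota i0.
  have rj' : (r < j)%N by lia.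
  rewrite !range // pc.
  have [u1 [e1 e1']] := prod_update (iota_uniq _ _) ir1 (rf 1).
  have [u0 [e0 e0']] := prod_update (iota_uniq _ _) ir1 (rf 0).
  rewrite e1 e0 !rfi in IH; rewrite e1' e0' !rf'i.
  move: IH; set W := z - w c; set gap := _ + _%:R.
  set cl1 := \prod_(1 <= i < _) col_factor D c 1 _.
  set cl0 := \prod_(1 <= i < _) col_factor D c 0 _.
  move/(congr1 ( *%R^~ ((z - v) * (z - v - 1)))) => IH.
  by apply: etrans (etrans _ IH) _; rewrite vE /W; ring.
- have pD : col D r.+1 c = i.-1 by rewrite -jr.
  have pD' : col D' r.+1 c = i by rewrite -jr.
  rewrite pD in IH; rewrite pD'.
  have rj' : (r < j)%N by lia.
  have i1 : (i.-1 < i)%N by lia.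
  rewrite !range //.
  have range_i d : \prod_(1 <= a < i) row_factor D' c d a =
      \prod_(1 <= a < i.-1.+1) row_factor D c d a.
    by rewrite -range' // prednK.
  rewrite !(big_nat_recr i) ?i0 //= !rf'i !range_i.
  move: IH; set W := z - w c.
  set rw1 := \prod_(1 <= i < _) row_factor D c 1 _.
  set rw0 := \prod_(1 <= i < _) row_factor D c 0 _.
  set cl1 := \prod_(1 <= i < _) col_factor D c 1 _.
  set cl0 := \prod_(1 <= i < _) col_factor D c 0 _.
  have rE' : r%:R = j%:R - 1 :> R by rewrite jr -addn1 natrD addrK.
  move/(congr1 ( *%R^~ (- (z - v) * ((z - v) ^+ 2 - 1)))) => IH.
  by apply: etrans (etrans _ IH) _; rewrite vE /W ?rE' ?iE; ring.
Qed.

End StripProducts.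

Section Hooks.
Variables (R : comNzRingType) (m : nat) (w : 'I_m -> R).
Implicit Types (D : seq (node m)) (x y : node m) (c : 'I_m) (d z : R).

Definition strip_num z D x : R :=
  (\prod_c strip w z D c x.1.2.-1 1) * \prod_(c | c != x.2) corner_gap w z D c x.1.2.-1.

Definition strip_den z D x : R := \prod_c strip w z D c x.1.2.-1 0.

(** The strips run over the columns to the left of the new node x and the rows met by its
    column number, the places where adding x changes hooks.  In the component of x the gap
    is z minus the residue of x, which is the zero split off for [phi_poly_regular]. *)
Lemma strip_num_den z D x : stacked D -> corner D x ->
  (z - node_value w x) * strip_num z D x * \prod_(y <- D) (z - node_value w y) ^+ 2 =
  strip_den z D x * (\prod_c (z - w c) * \prod_(y <- D) ((z - node_value w y) ^+ 2 - 1)).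
Proof.
case: x => [[i j] k] sD cx; rewrite /strip_num /strip_den /=.
have /and5P[i0 j0 _ _ _] := cx.
have -> : z - node_value w (i, j, k) = corner_gap w z D k j.-1.
  rewrite /corner_gap prednK // (col_corner sD cx) /node_value /=.
  have iE : i%:R = i.-1%:R + 1 :> R by rewrite -[in LHS](prednK i0) -addn1 natrD.
  have jE : j%:R = j.-1%:R + 1 :> R by rewrite -[in LHS](prednK j0) -addn1 natrD.
  by rewrite iE jE; ring.
have -> : corner_gap w z D k j.-1 * (\prod_c strip w z D c j.-1 1 *
    \prod_(c | c != k) corner_gap w z D c j.-1) =
    \prod_c (corner_gap w z D c j.-1 * strip w z D c j.-1 1).
  by rewrite [RHS]big_split /= [X in _ = X * _](bigD1 k) //=; ring.
have part (F : node m -> R) : \prod_(y <- D) F y = \prod_c \prod_(y <- D | y.2 == c) F y.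
  by rewrite (partition_big (fun y : node m => y.2) xpredT).
rewrite !part -!big_split /=; apply: eq_bigr => c _.
by rewrite strip_identity // [strip _ _ _ _ _ _ * _]mulrCA mulrA.
Qed.

(** The factor h + q_s - q_t of the inverse of Theta, for the node y in component s and t = c. *)
Definition hook D y c : R :=
  w y.2 + (row D y.1.1 y.2)%:R - y.1.1%:R + (col D y.1.2 c)%:R - y.1.2%:R + 1 - w c.

Definition hook_prod D : R := \prod_(y <- D) \prod_c hook D y c.

Lemma prod_row D i c (F : node m -> R) : stacked D ->
  \prod_(y <- D | (y.1.1 == i) && (y.2 == c)) F y = \prod_(1 <= j < (row D i c).+1) F (i, j, c).
Proof.
move=> sD; rewrite -big_filter (perm_big [seq (i, j, c) | j <- index_iota 1 (row D i c).+1]).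
  by rewrite big_map.
apply: uniq_perm; first by rewrite filter_uniq ?stacked_uniq.
  by rewrite map_inj_uniq ?iota_uniq // => j j' [].
move=> [[a b] k]; rewrite mem_filter mem_row //=; apply/idP/mapP.
  case/andP => /andP[/eqP-> /eqP->] /and3P[_ b0 bi]; exists b => //.
  by rewrite mem_index_iota b0 ltnS.
move=> [j]; rewrite mem_index_iota ltnS => /andP[j0 ji] [-> -> ->]; rewrite !eqxx j0 ji /= andbT.
have : has (fun y : node m => (y.1.1 == i) && (y.2 == c)) D.
  by rewrite has_count; apply: leq_trans ji.
by case/hasP => -[[a' b'] c'] yD /andP[/= /eqP <- _]; move: yD; rewrite mem_row // => /andP[].
Qed.

Lemma prod_col D j c (F : node m -> R) : stacked D ->
  \prod_(y <- D | (y.1.2 == j) && (y.2 == c)) F y = \prod_(1 <= i < (col D j c).+1) F (i, j, c).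
Proof.
move=> sD; rewrite -big_filter (perm_big [seq (i, j, c) | i <- index_iota 1 (col D j c).+1]).
  by rewrite big_map.
apply: uniq_perm; first by rewrite filter_uniq ?stacked_uniq.
  by rewrite map_inj_uniq ?iota_uniq // => i i' [].
move=> [[a b] k]; rewrite mem_filter mem_col //=; apply/idP/mapP.
  case/andP => /andP[/eqP-> /eqP->] /and3P[a0 _ aj]; exists a => //.
  by rewrite mem_index_iota a0 ltnS.
move=> [i]; rewrite mem_index_iota ltnS => /andP[i0 ij] [-> -> ->]; rewrite !eqxx i0 ij /= andbT.
have : has (fun y : node m => (y.1.2 == j) && (y.2 == c)) D.
  by rewrite has_count; apply: leq_trans ij.
by case/hasP => -[[a' b'] c'] yD /andP[/= /eqP <- _]; move: yD; rewrite mem_row // => /and3P[].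
Qed.

(** Adding x lengthens the arms of the nodes to its left, which enter hooks towards every
    component, and the legs of the nodes of every component that lie in its column number,
    which enter their hooks towards the component of x.  At z = res x these hooks are the
    factors of the strips, with d = 0 before and d = 1 after; the hooks of x are the gaps. *)
Lemma hook_prod_cons D x : stacked D -> corner D x ->
  hook_prod (x :: D) * strip_den (node_value w x) D x =
  hook_prod D * strip_num (node_value w x) D x.
Proof.
case: x => [[i j] k] sD cx; set x := (i, j, k); set z := node_value w x.
have /and5P[i0 j0 nD _ _] := cx.
have rDi := row_corner sD cx; have cDj := col_corner sD cx.
have rowE a c : row (x :: D) a c = ((i == a) && (k == c) + row D a c)%N by [].
have colE b c : col (x :: D) b c = ((j == b) && (k == c) + col D b c)%N by [].
have iE : i%:R = i.-1%:R + 1 :> R by rewrite -[in LHS](prednK i0) -addn1 natrD.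
have jE : j%:R = j.-1%:R + 1 :> R by rewrite -[in LHS](prednK j0) -addn1 natrD.
(* the hook factors through the new node itself *)
have hx : \prod_c hook (x :: D) x c = \prod_(c | c != k) corner_gap w z D c j.-1.
  rewrite (bigD1 k) //= [hook _ _ _](_ : _ = 1) ?mul1r; last first.
    by rewrite /hook /= rowE colE !eqxx rDi cDj /= !add1n !prednK //; ring.
  apply: eq_bigr => c ck; rewrite /hook /corner_gap /= rowE colE !eqxx rDi eq_sym (negbTE ck).
  by rewrite prednK // andbF add0n add1n prednK // /z /node_value /= jE; ring.
(* the other nodes whose hooks change lie in the row or the column of the new node *)
pose g d y := if (y.1.1 == i) && (y.2 == k) then \prod_c col_factor w z D c d y.1.2
  else if y.1.2 == j then row_factor w z D y.2 d y.1.1 else 1.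
have hy y : y \in D -> \prod_c hook (x :: D) y c * g 0 y = \prod_c hook D y c * g 1 y.
  case: y => [[a b] c'] yD; rewrite /g /=.
  have [/andP[/eqP ai /eqP ck]|nrow] := boolP ((a == i) && (c' == k)).
    rewrite ai ck in yD *; have bj : (j == b) = false.
      by apply: contraNF nD => /eqP->.
    rewrite -!big_split /=; apply: eq_bigr => c _; rewrite /hook /= rowE colE !eqxx bj rDi /=.
    by rewrite /col_factor add0n add1n prednK // /z /node_value /= jE; ring.
  have rE : row (x :: D) a c' = row D a c' by rewrite rowE eq_sym [k == c']eq_sym (negbTE nrow).
  have [bj|bj] := eqVneq b j; last first.
    rewrite !mulr1; apply: eq_bigr => c _; rewrite /hook /= rE colE eq_sym (negbTE bj) //.
  rewrite !(bigD1 k (P := xpredT)) //= bj.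
  have -> : \prod_(c | c != k) hook (x :: D) (a, j, c') c = \prod_(c | c != k) hook D (a, j, c') c.
    by apply: eq_bigr => c ck; rewrite /hook /= rE colE eqxx eq_sym (negbTE ck).
  rewrite /hook /= rE colE !eqxx cDj /row_factor /= add1n prednK // /z /node_value /= iE.
  by ring.
have gE d : \prod_(y <- D) g d y = \prod_c strip w z D c j.-1 d.
  rewrite (bigID (fun y : node m => (y.1.1 == i) && (y.2 == k))) /=.
  rewrite (eq_bigr (fun y : node m => \prod_c col_factor w z D c d y.1.2)); last first.
    by move=> y rowy; rewrite /g rowy.
  rewrite prod_row // rDi exchange_big /= big_split /=; congr (_ * _).
  rewrite (eq_bigr (fun y : node m =>
      if y.1.2 == j then row_factor w z D y.2 d y.1.1 else 1)); last first.
    by move=> y rowy; rewrite /g (negbTE rowy).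
  rewrite -big_mkcondr /= (partition_big (fun y : node m => y.2) xpredT) //=.
  apply: eq_bigr => c _; rewrite prednK //.
  rewrite -(prod_col j c (fun y => row_factor w z D c d y.1.1)) //.
  rewrite big_seq_cond [RHS]big_seq_cond; apply: eq_big => [y|y /andP[_ /andP[_ /eqP->]]] //.
  case: y => [[a b] c'] /=; case: (boolP (_ \in D)) => //= yD.
  have [bj|] := eqVneq b j; rewrite ?andbF //= ?andbT; apply: andb_idl => /eqP ck.
  rewrite bj in yD.
  apply/negP => /andP[/eqP ai /eqP kk]; by move: nD; rewrite -ai -kk yD.
rewrite /hook_prod big_cons hx /strip_num /strip_den /= -!gE -mulrA -big_split /=.
rewrite mulrC [RHS]mulrA -big_split /=; congr (_ * _).
by rewrite big_seq [RHS]big_seq; apply: eq_bigr => y; exact: hy.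
Qed.

End Hooks.

Section StripMorphism.
Variables (R R' : comNzRingType) (f : {rmorphism R -> R'}) (m : nat) (w : 'I_m -> R) (z : R).
Implicit Types (D : seq (node m)) (x y : node m).

Lemma rmorph_strip D c r d : f (strip w z D c r d) = strip (f \o w) (f z) D c r (f d).
Proof.
rewrite rmorphM !rmorph_prod; congr (_ * _); apply: eq_bigr => j _.
  by rewrite /col_factor !(rmorphD, rmorphN) !rmorph_nat.
by rewrite /row_factor !(rmorphD, rmorphN) !rmorph_nat.
Qed.

Lemma rmorph_strip_num D x : f (strip_num w z D x) = strip_num (f \o w) (f z) D x.
Proof.
rewrite rmorphM !rmorph_prod; congr (_ * _); apply: eq_bigr => c _.
  by rewrite rmorph_strip rmorph1.
by rewrite /corner_gap !(rmorphD, rmorphN) !rmorph_nat.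
Qed.

Lemma rmorph_strip_den D x : f (strip_den w z D x) = strip_den (f \o w) (f z) D x.
Proof. by rewrite rmorph_prod; apply: eq_bigr => c _; rewrite rmorph_strip rmorph0. Qed.

End StripMorphism.

Section HookValues.
Variables (K : fieldType) (m n : nat) (q : 'I_m -> K).
Implicit Types (D : seq (node m)) (x y : node m) (la : m.-tuple intpart).
Hypothesis gen : generic n q.

Lemma residue_node_value y : residue q y = node_value q y.
Proof. by case: y => [[a b] c]; rewrite /residue rmorphB. Qed.

(** Within one component hooks lie between 1 and n, across components between -n and n. *)
Lemma hook_neq0 D y c : stacked D -> (size D <= n)%N -> y \in D -> hook q D y c != 0.
Proof.
case: gen => [gen1 gen2]; case: y => [[i j] k] sD szD yD.
have := yD; rewrite (mem_row sD) => /and3P[i0 j0 jr].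
have := yD; rewrite (mem_col sD) => /and3P[_ _ ic].
have h1 := row_col_le i j k k sD; have h2 := row_col_le i j k c sD.
rewrite eqxx in h1; pose d := (row D i k)%:Z - i%:Z + (col D j c)%:Z - j%:Z + 1.
have -> : hook q D (i, j, k) c = d%:~R + q k - q c.
  by rewrite /hook /d /= !(rmorphD, rmorphN) /=; ring.
have [ck|ck] := eqVneq k c.
  rewrite -ck addrK; apply: gen1; rewrite /d -ck; lia.
by apply: gen2 => //; rewrite (negbTE ck) in h2; rewrite /d; lia.
Qed.

Lemma hook_prod_neq0 D : stacked D -> (size D <= n)%N -> hook_prod q D != 0.
Proof.
move=> sD szD; rewrite prodf_seq_neq0; apply/allP => y yD /=.
by apply/prodf_neq0 => c _; exact: hook_neq0.
Qed.

(** At the residue of x each factor of the denominator is a hook of D. *)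
Lemma strip_den_neq0 D x : stacked D -> (size D <= n)%N -> corner D x ->
  strip_den q (residue q x) D x != 0.
Proof.
case: x => [[i j] k] sD szD cx; rewrite residue_node_value.
have /and5P[i0 j0 _ _ _] := cx; have rDi := row_corner sD cx; have cDj := col_corner sD cx.
have iE : i%:R = i.-1%:R + 1 :> K by rewrite -[in LHS](prednK i0) -addn1 natrD.
have jE : j%:R = j.-1%:R + 1 :> K by rewrite -[in LHS](prednK j0) -addn1 natrD.
apply/prodf_neq0 => c _; rewrite /strip /= prednK // mulf_eq0 negb_or !prodf_seq_neq0.
apply/andP; split; apply/allP => l; rewrite mem_index_iota => /andP[l0 ll] /=.
  have -> : col_factor q (node_value q (i, j, k)) D c 0 l = hook q D (i, l, k) c.
    by rewrite /hook /col_factor /node_value /= rDi jE; ring.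
  by apply: hook_neq0; rewrite // (mem_row sD) rDi i0 l0; lia.
have -> : row_factor q (node_value q (i, j, k)) D c 0 l = hook q D (l, j, c) k.
  by rewrite /hook /row_factor /node_value /= cDj iE; ring.
by apply: hook_neq0; rewrite // (mem_col sD) j0 l0; lia.
Qed.

Lemma part_cells_uniq (la : intpart) : uniq (part_cells la).
Proof.
apply: allpairs_uniq_dep => [|a _|]; rewrite ?iota_uniq //.
by move=> [a b] [a' b'] _ _ /= [-> ->].
Qed.

Lemma diagram_uniq la : uniq (diagram la).
Proof.
apply: allpairs_uniq_dep => [|c _|]; rewrite ?enum_uniq ?part_cells_uniq //.
by move=> [c y] [c' y'] _ _ /= [-> ->].
Qed.

Lemma diagram_row D la a c : stacked D -> D =i diagram la -> (0 < a)%N ->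
  row D a c = part_row (tnth la c) a.
Proof.
move=> sD DE a0; have E b := DE (a, b, c).
apply/eqP; rewrite eqn_leq; apply/andP; split.
  case: (posnP (row D a c)) => [-> //|r0]; have := E (row D a c).
  by rewrite (mem_row sD) mem_diagram a0 r0 leqnn /= => <-.
case: (posnP (part_row (tnth la c) a)) => [-> //|r0]; have := E (part_row (tnth la c) a).
by rewrite (mem_row sD) mem_diagram a0 r0 leqnn /= => ->.
Qed.

Lemma diagram_col D la b c : stacked D -> D =i diagram la -> (0 < b)%N ->
  col D b c = part_col (tnth la c) b.
Proof.
move=> sD DE b0; rewrite /part_col -[intpart_seq _ in RHS](mkseq_nth 0%N) count_map.
rewrite /col -!size_filter -(size_map (fun i => (i.+1, b, c))); apply: perm_size.
apply: uniq_perm; first by rewrite filter_uniq ?stacked_uniq.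
  by rewrite map_inj_uniq ?filter_uniq ?iota_uniq // => i i' [].
move=> [[a b'] c']; rewrite mem_filter DE mem_diagram /=; apply/idP/mapP.
  case/andP => /andP[/eqP-> /eqP->] /and3P[a0 _ ba]; exists a.-1; last by rewrite prednK.
  rewrite mem_filter mem_iota /= add0n; move: ba; rewrite /part_row => ba; rewrite ba /=.
  by rewrite ltnNge; apply: contraTN ba => sz; rewrite nth_default // -ltnNge.
by move=> [i]; rewrite mem_filter => /andP[/= bi _] [-> -> ->]; rewrite !eqxx b0.
Qed.

Lemma Theta_hook_prod D la : stacked D -> D =i diagram la -> Theta q la = (hook_prod q D)^-1.
Proof.
move=> sD DE; rewrite /hook_prod (perm_big (diagram la)) /=; last first.
  by apply: uniq_perm (stacked_uniq sD) (diagram_uniq la) DE.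
rewrite /diagram big_allpairs_dep big_enum /= -prodfV; apply: eq_bigr => c _.
rewrite -prodfV big_seq [RHS]big_seq; apply: eq_bigr => -[a b].
rewrite mem_part_cells -prodfV => /and3P[a0 b0 _]; apply: eq_bigr => c' _.
congr (_^-1); rewrite /hook /theta_hook /= (diagram_row _ sD DE) // (diagram_col _ sD DE) //.
by rewrite !(rmorphD, rmorphN) /=; ring.
Qed.

End HookValues.

(** * Consecutive evaluation of rational functions *)

Lemma rmorph_phi_num (B B' : pzRingType) (f : {rmorphism B -> B'}) z tz w b k :
  f (phi_num z tz w b k) = phi_num (f z) (f tz) (f \o w) (f \o b) k.
Proof.
elim: k => [|[|k] IH] //=; first exact: rmorph1.
by rewrite 2!rmorphM rmorphD rmorph1 rmorphM rmorphB; congr (_ * _ * _); exact: IH.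
Qed.

Lemma eq_phi_num (B : pzRingType) (z tz : B) w w' b k :
  (forall i, (0 < i < k)%N -> w i = w' i) -> phi_num z tz w b k = phi_num z tz w' b k.
Proof.
elim: k => [|[|k] IH] //= ww'; rewrite ww' ?leqnn //; congr (_ * _ * _).
by apply: IH => i ik; apply: ww'; lia.
Qed.

Section CentralSubstitution.
Variables (K : fieldType) (A : algType K) (n : nat).
Local Notation alg := (@mpoly_alg K A n).
Implicit Types (d e : {mpoly K[n]}) (p : {mpoly A[n]}).

HB.instance Definition _ := GRing.RMorphism.copy alg (map_mpoly (in_alg A)).

Lemma mpoly_algC (a : K) : alg a%:MP = (a%:A)%:MP.
Proof. exact: map_mpolyC. Qed.

Lemma mpoly_algX i : alg 'X_i = 'X_i.
Proof. exact: map_mpolyX. Qed.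

Lemma mpoly_alg_zvar k : alg (zvar n K k) = zvar n A k.
Proof. by rewrite /zvar; case: insub => [i|] /=; [exact: mpoly_algX | exact: rmorph0]. Qed.

Lemma mpoly_algC_comm (a : K) p : GRing.comm p (a%:A)%:MP.
Proof.
elim/mpolyind: p => [|b u p _ _ IH]; first exact/commr_sym/commr0.
apply/commr_sym/commrD; last exact: commr_sym.
rewrite -mul_mpolyC; apply: commrM; last exact: commr_mpolyX.
by rewrite /GRing.comm -!mpolyCM mulr_algl mulr_algr.
Qed.

Lemma mpoly_alg_comm d p : GRing.comm p (alg d).
Proof.
elim/mpolyind: d => [|b u d _ _ IH]; first by rewrite rmorph0; exact: commr0.
rewrite -mul_mpolyC rmorphD rmorphM /= mpoly_algC; apply: commrD => //.
by apply: commrM; [exact: mpoly_algC_comm | rewrite /mpoly_alg map_mpolyX; exact: commr_mpolyX].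
Qed.

Lemma eval_commr e : commr_rmorph (@mpolyC n A) (alg e).
Proof. by move=> a; apply/commr_sym/mpoly_alg_comm. Qed.

(** Central values are the only ones at which evaluation is multiplicative over the
    non-commutative A; all the arguments of the fusion function are of this kind. *)
Definition eval_at e : {poly A} -> {mpoly A[n]} := horner_morph (eval_commr e).

HB.instance Definition _ e := GRing.RMorphism.copy (eval_at e) (horner_morph (eval_commr e)).

Lemma eval_atX e : eval_at e 'X = alg e.
Proof. exact: horner_morphX. Qed.

Lemma eval_atC e a : eval_at e a%:P = a%:MP.
Proof. exact: horner_morphC. Qed.

Definition keval_at e (d : {poly K}) : {mpoly K[n]} := (map_poly (@mpolyC n K) d).[e].

Lemma eval_at_central e (d : {poly K}) : eval_at e (central_poly A d) = alg (keval_at e d).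
Proof.
elim/poly_ind: d => [|d a IH]; first by rewrite /keval_at !rmorph0 horner0 rmorph0.
rewrite /keval_at !rmorphD !rmorphM /= !central_polyX central_polyC map_polyX map_polyC.
rewrite hornerD hornerM hornerX hornerC rmorphD rmorphM /= -/(keval_at e d) -IH.
by rewrite eval_atX eval_atC mpoly_algC.
Qed.

Lemma eval_at_const (a : K) (P : {poly A}) : eval_at a%:MP P = (P.[a%:A])%:MP.
Proof. by rewrite /eval_at /horner_morph mpoly_algC horner_map. Qed.

Lemma keval_at_const (a : K) (d : {poly K}) : keval_at a%:MP d = (d.[a])%:MP.
Proof. exact: horner_map. Qed.

Section Substitution.
Variables (i : 'I_n) (r : K).
Definition substA : {mpoly A[n]} -> {mpoly A[n]} := mpoly_subst i r%:A.
Definition substK : {mpoly K[n]} -> {mpoly K[n]} := mpoly_subst i r.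

Lemma substA_zmod : zmod_morphism substA.
Proof. exact: mmap_is_additive. Qed.

Lemma substA_monoid : monoid_morphism substA.
Proof.
have hc (j : 'I_n) x : GRing.comm x ((if j == i then r%:A%:MP else 'X_j) : {mpoly A[n]}).
  by case: ifP => _; [exact: mpoly_algC_comm | exact: commr_mpolyX].
have [|SM S1] := @commr_mmap_is_multiplicative n A {mpoly A[n]} _ (@mpolyC n A) hc.
  by move=> u k k'; apply: commr_prod => j _; apply: commrX; apply: hc.
by split.
Qed.

HB.instance Definition _ :=
  GRing.isZmodMorphism.Build {mpoly A[n]} {mpoly A[n]} substA substA_zmod.
HB.instance Definition _ :=
  GRing.isMonoidMorphism.Build {mpoly A[n]} {mpoly A[n]} substA substA_monoid.

HB.instance Definition _ := GRing.RMorphism.copy substK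
  (mmap (@mpolyC n K) (fun j => if j == i then r%:MP else 'X_j)).

Lemma substAC a : substA a%:MP = a%:MP. Proof. exact: mmapC. Qed.
Lemma substKC a : substK a%:MP = a%:MP. Proof. exact: mmapC. Qed.

Lemma substKX j : substK 'X_j = if j == i then r%:MP else 'X_j.
Proof. by rewrite /substK /mpoly_subst mmapX mmap1U. Qed.

Lemma substA_monomial (u : 'X_{1..n}) : substA 'X_[u] = alg (substK 'X_[u]).
Proof.
rewrite /substA /substK /mpoly_subst !mmapX /mmap1 rmorph_prod /=; apply: eq_bigr => j _.
rewrite rmorphXn /=; congr (_ ^+ _).
by case: ifP => _; rewrite ?mpoly_algC ?mpoly_algX.
Qed.

Lemma substA_alg d : substA (alg d) = alg (substK d).
Proof.
have algD x y : alg (x + y) = alg x + alg y by exact: rmorphD.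
have algM x y : alg (x * y) = alg x * alg y by exact: rmorphM.
have sAD x y : substA (x + y) = substA x + substA y by exact: rmorphD.
have sAM x y : substA (x * y) = substA x * substA y by exact: rmorphM.
have sKD x y : substK (x + y) = substK x + substK y by exact: rmorphD.
have sKM x y : substK (x * y) = substK x * substK y by exact: rmorphM.
elim/mpolyind: d => [|b u d _ _ IH]; first by rewrite !rmorph0.
rewrite -mul_mpolyC algD algM sAD sAM sKD sKM algD algM IH -substA_monomial.
by rewrite mpoly_algC substAC substKC mpoly_algC /mpoly_alg map_mpolyX.
Qed.

Lemma substA_eval e P : substA (eval_at e P) = eval_at (substK e) P.
Proof.
elim/poly_ind: P => [|P a IH]; first by rewrite !rmorph0.
by rewrite !rmorphD !rmorphM /= IH !eval_atX !eval_atC substAC substA_alg.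
Qed.

End Substitution.
End CentralSubstitution.

Section ConsecutiveEvaluation.
Variables (K : fieldType) (m n : nat) (q : 'I_m -> K).
Variables (A : algType K) (t : A) (s : nat -> A) (c : nat -> K) (v : nat -> A).
Local Notation alg := (@mpoly_alg K A n).

Definition evaluated_vars k i : {mpoly K[n]} := if (i <= k)%N then (c i)%:MP else zvar n K i.
Local Notation zeta := evaluated_vars.

(** Numerator and denominator of phi_k(w_1, .., w_(k-1); w_j), kept in the form produced by
    the arithmetic of fractions. *)
Definition phi_num_of (w : nat -> {mpoly K[n]}) k j : {mpoly A[n]} :=
  phi_num (alg (w j)) (eval_at (w j) (baxter_t q t)) (fun i => alg (w i))
    (fun i => (s i)%:MP) k.

Definition phi_den_of (w : nat -> {mpoly K[n]}) k j : {mpoly K[n]} :=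
  \prod_(1 <= i < k) (w j - w i).

(** The factors phi_n, .., phi_(k+1), which still contain a free variable after k evaluations. *)
Definition rest_num w k := \prod_(j <- rev (index_iota k.+1 n.+1)) phi_num_of w j j.
Definition rest_den w k := \prod_(j <- rev (index_iota k.+1 n.+1)) phi_den_of w j j.

Lemma zvarE (R : nzRingType) k (kn : (k < n)%N) : zvar n R k.+1 = 'X_(Ordinal kn).
Proof. by rewrite /zvar /= insubT. Qed.

Lemma zvar_sub_neq0 j i : (0 < i < j)%N -> (j <= n)%N -> zvar n K j - zvar n K i != 0.
Proof.
case: j => [|j]; first by rewrite ltn0 andbF.
case: i => // i /andP[_ ij] jn; have iN : (i < n)%N by lia.
rewrite (zvarE K jn) (zvarE K iN); apply/eqP => /(congr1 (mcoeff U_(Ordinal jn)))/eqP.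
by rewrite mcoeffB !mcoeffXU eqxx -val_eqE /= mcoeff0 (ltn_eqF _) ?subr0 ?oner_eq0.
Qed.

Lemma zvar_subC_neq0 j (a : K) : (0 < j <= n)%N -> zvar n K j - a%:MP != 0.
Proof.
case: j => // j jn; rewrite (zvarE K jn); apply/eqP => /(congr1 (mcoeff U_(Ordinal jn)))/eqP.
by rewrite mcoeffB mcoeffXU eqxx mcoeffC mcoeff0 mnm1_eq0 mulr0 subr0 oner_eq0.
Qed.

Lemma rf_invE (d : {mpoly K[n]}) : d != 0 -> rf_num (rf_inv A d) = 1 /\ rf_den (rf_inv A d) = d.
Proof. by rewrite /rf_inv => d0; case: insubP => [e _ <-|]; last by rewrite d0. Qed.

Lemma fusion_phiE k j : (0 < k <= j)%N -> (j <= n)%N ->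
  rf_num (fusion_phi n q t s k j) = phi_num_of (zvar n K) k j /\
  rf_den (fusion_phi n q t s k j) = phi_den_of (zvar n K) k j.
Proof.
elim: k => // -[_ _ jn|k IH /andP[_ kj] jn].
  rewrite /phi_den_of big_geq //; split=> //.
  by rewrite /phi_num_of /= /eval_at /horner_morph mpoly_alg_zvar.
have [||IHn IHd] := IH; [lia | by [] |].
have d0 : zvar n K j - zvar n K k.+1 != 0 by apply: zvar_sub_neq0; rewrite ?kj.
have [in1 id1] := rf_invE d0; split.
  transitivity ((alg 1 * rf_num (rf_inv A (zvar n K j - zvar n K k.+1)) +
     alg (rf_den (rf_inv A (zvar n K j - zvar n K k.+1))) * (s k.+1)%:MP) *
     rf_num (fusion_phi n q t s k.+1 j) * (s k.+1)%:MP) => //.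
  have a1 : alg 1 = 1 by exact: rmorph1.
  have aB : alg (zvar n K j - zvar n K k.+1) = alg (zvar n K j) - alg (zvar n K k.+1).
    exact: rmorphB.
  by rewrite in1 id1 IHn a1 mulr1 aB.
transitivity (rf_den (rf_inv A (zvar n K j - zvar n K k.+1)) * 1 *
  rf_den (fusion_phi n q t s k.+1 j) * 1) => //.
by rewrite id1 IHd !mulr1 /phi_den_of [RHS]big_nat_recr //= mulrC.
Qed.

Lemma fusion_PhiE k : (k <= n)%N ->
  rf_num (fusion_Phi n q t s k) =
    \prod_(j <- rev (index_iota 1 k.+1)) phi_num_of (zvar n K) j j /\
  rf_den (fusion_Phi n q t s k) =
    \prod_(j <- rev (index_iota 1 k.+1)) phi_den_of (zvar n K) j j.
Proof.
elim: k => [_|k IH kn]; first by rewrite !big_nil.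
have [IHn IHd] := IH (ltnW kn).
have [||pn pd] := @fusion_phiE k.+1 k.+1; [by rewrite leqnn | by [] |].
have -> : rev (index_iota 1 k.+2) = k.+1 :: rev (index_iota 1 k.+1).
  have -> : index_iota 1 k.+2 = rcons (index_iota 1 k.+1) k.+1.
    by rewrite /index_iota !subSS !subn0 -[k.+1 in LHS]addn1 iotaD cats1 add1n.
  by rewrite rev_rcons.
by rewrite !big_cons -IHn -IHd -pn -pd.
Qed.

Lemma eq_rest w w' k : (forall i, (0 < i <= n)%N -> w i = w' i) ->
  rest_num w k = rest_num w' k /\ rest_den w k = rest_den w' k.
Proof.
move=> ww'; split; rewrite /rest_num /rest_den big_seq [RHS]big_seq; apply: eq_bigr => j;
  rewrite mem_rev mem_index_iota => /andP[kj jn].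
  rewrite /phi_num_of ww'; last by lia.
  by apply: eq_phi_num => i ij; rewrite ww' //; lia.
rewrite /phi_den_of big_nat [RHS]big_nat; apply: eq_bigr => i ij.
by rewrite !ww' //; lia.
Qed.

Lemma rest_recr w k : (k < n)%N ->
  rest_num w k = rest_num w k.+1 * phi_num_of w k.+1 k.+1 /\
  rest_den w k = rest_den w k.+1 * phi_den_of w k.+1 k.+1.
Proof.
move=> kn; have iE : rev (index_iota k.+1 n.+1) = rcons (rev (index_iota k.+2 n.+1)) k.+1.
  by rewrite /index_iota -rev_cons subSS -[(n - k)%N](prednK _) ?subn_gt0 // -subnS subSS.
by rewrite /rest_num /rest_den iE !big_rcons /= ?mulr1.
Qed.

Lemma rest_den_neq0 k : rest_den (zeta k) k != 0.
Proof.
rewrite prodf_seq_neq0; apply/allP => j; rewrite mem_rev mem_index_iota => /andP[kj jn] /=.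
rewrite prodf_seq_neq0; apply/allP => i; rewrite mem_index_iota => /andP[i0 ij] /=.
rewrite /zeta [(j <= k)%N]leqNgt kj /=; case: ifP => _; first by apply: zvar_subC_neq0; lia.
by apply: zvar_sub_neq0; rewrite ?i0.
Qed.

Lemma substK_zeta k (kn : (k < n)%N) i : substK (Ordinal kn) (c k.+1) (zeta k i) = zeta k.+1 i.
Proof.
rewrite /zeta; case: leqP => [ik|ki]; first by rewrite substKC leqW.
rewrite leq_eqVlt ltnS leqNgt ki orbF; case: i ki => // i ki.
have [iN|iN] := ltnP i n.
  by rewrite (zvarE K iN) substKX -val_eqE /= eqSS; case: eqVneq => [->|].
rewrite (gtn_eqF _); last by lia.
by rewrite /zvar insubF ?rmorph0 //= ltnNge iN.
Qed.

Lemma substA_phi k (kn : (k < n)%N) j :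
  substA (A := A) (Ordinal kn) (c k.+1) (phi_num_of (zeta k) j j) = phi_num_of (zeta k.+1) j j.
Proof.
pose sA := @substA K A n (Ordinal kn) (c k.+1).
have M z tz w b l : sA (phi_num z tz w b l) = phi_num (sA z) (sA tz) (sA \o w) (sA \o b) l.
  exact: rmorph_phi_num.
rewrite /phi_num_of -/sA M /sA substA_alg substA_eval substK_zeta.
rewrite (eq_phi_num _ _ (w' := fun i => alg (zeta k.+1 i))); last first.
  by move=> i _ /=; rewrite substA_alg substK_zeta.
congr phi_num. by apply/funext => i; rewrite /= substAC.
Qed.

(** Whatever its denominator in general, phi_(k+1) multiplied by the value v_k reached so far
    can be written as w / d with d nonzero at c_(k+1). *)
Definition regular_step k : Prop := exists (d : {poly K}) (w : {poly A}),
  [/\ phi_num 'X (baxter_t q t) (fun i => (c i)%:A%:P) (fun i => (s i)%:P) k.+1 *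
        (v k)%:P * central_poly A d =
      central_poly A (\prod_(1 <= i < k.+1) ('X - (c i)%:P)) * w,
      d.[c k.+1] != 0 & w.[(c k.+1)%:A] = d.[c k.+1] *: v k.+1].

Definition stage k : ratfun A n :=
  Ratfun (rest_num (zeta k) k * (v k)%:MP) (rest_den_neq0 k).

(** The fraction is rewritten with phi_(k+1) v_k replaced by its regular form; no other
    factor acquires a pole, since its denominators still contain a free variable. *)
Lemma stage_value k (kn : (k < n)%N) (f : ratfun A n) : regular_step k ->
  rf_num f = rest_num (zeta k) k * (v k)%:MP -> rf_den f = rest_den (zeta k) k ->
  rf_value_at (Ordinal kn) (c k.+1) f (stage k.+1).
Proof.
move=> [d [w [dw d0 wv]]] fn fd; set z := zeta k k.+1.
have algM x y : alg (x * y) = alg x * alg y by exact: rmorphM.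
have algC (p : {mpoly A[n]}) e : alg e * p = p * alg e by rewrite (mpoly_alg_comm e p).
have key : phi_num_of (zeta k) k.+1 k.+1 * (v k)%:MP * alg (keval_at z d) =
    alg (phi_den_of (zeta k) k.+1 k.+1) * eval_at z w.
  have := congr1 (eval_at z) dw.
  have evM x y : eval_at z (x * y) = eval_at z x * eval_at z y by exact: rmorphM.
  rewrite !evM !eval_at_central eval_atC => E.
  have -> : phi_num_of (zeta k) k.+1 k.+1 = eval_at z (phi_num 'X (baxter_t q t)
      (fun i => (c i)%:A%:P) (fun i => (s i)%:P) k.+1).
    have M z' tz w' b l : eval_at z (phi_num z' tz w' b l) = phi_num (eval_at z z')
        (eval_at z tz) (eval_at z \o w') (eval_at z \o b) l by exact: rmorph_phi_num.
    rewrite M eval_atX /phi_num_of (eq_phi_num _ _ (w' := eval_at z \o (fun i => (c i)%:A%:P))).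
      by congr phi_num; apply/funext => i; rewrite /= eval_atC.
    by move=> i; rewrite ltnS /zeta => /andP[_ ->]; rewrite /= eval_atC mpoly_algC.
  rewrite E; congr (alg _ * _); rewrite /keval_at rmorph_prod horner_prod.
  apply: eq_big_nat => i; rewrite ltnS => /andP[_ ik].
  by rewrite rmorphB /= map_polyX map_polyC hornerXsubC /= /z /zeta ik.
pose den := rest_den (zeta k) k.+1 * keval_at z d.
have sden : substK (Ordinal kn) (c k.+1) den = rest_den (zeta k.+1) k.+1 * (d.[c k.+1])%:MP.
  pose sK := @substK K n (Ordinal kn) (c k.+1).
  have sKM x y : sK (x * y) = sK x * sK y by exact: rmorphM.
  have sKprod I r (F : I -> {mpoly K[n]}) : sK (\prod_(i <- r) F i) = \prod_(i <- r) sK (F i).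
    exact: rmorph_prod.
  have sKB x y : sK (x - y) = sK x - sK y by exact: rmorphB.
  rewrite -/sK /den sKM /rest_den sKprod; congr (_ * _).
    apply: eq_bigr => j _; rewrite /phi_den_of sKprod; apply: eq_bigr => i _.
    by rewrite sKB /sK !substK_zeta.
  rewrite -keval_at_const /keval_at /sK.
  have -> : (c k.+1)%:MP = substK (Ordinal kn) (c k.+1) z by rewrite substK_zeta /zeta leqnn.
  rewrite -horner_map /= -map_poly_comp; congr (_.[_]); apply: eq_map_poly => a /=.
  by rewrite substKC.
have sden0 : substK (Ordinal kn) (c k.+1) den != 0.
  by rewrite sden mulf_neq0 ?rest_den_neq0 // mpolyC_eq0.
have den0 : den != 0 by apply: contraNneq sden0 => ->; rewrite rmorph0.
exists (Ratfun (rest_num (zeta k) k.+1 * eval_at z w) den0), sden0; split.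
  have [rn rd] := rest_recr (zeta k) kn.
  rewrite /rf_eq /= fn fd rn rd !algM -[LHS]mulrA -[RHS]mulrA; congr (_ * _).
  rewrite algC [RHS]mulrA (algC (rest_num _ _)) -[RHS]mulrA -key.
  by rewrite !mulrA.
rewrite /rf_eq /= -/(substK (Ordinal kn) (c k.+1) den) sden.
rewrite -/(substA (Ordinal kn) (c k.+1) (rest_num (zeta k) k.+1 * eval_at z w)).
pose sA := @substA K A n (Ordinal kn) (c k.+1); rewrite -/sA.
have sAM x y : sA (x * y) = sA x * sA y by exact: rmorphM.
have sAprod r (F : nat -> {mpoly A[n]}) : sA (\prod_(i <- r) F i) = \prod_(i <- r) sA (F i).
  exact: rmorph_prod.
have sAw : sA (eval_at z w) = (d.[c k.+1] *: v k.+1)%:MP.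
  by rewrite /sA substA_eval substK_zeta /zeta leqnn eval_at_const wv.
have sAr : sA (rest_num (zeta k) k.+1) = rest_num (zeta k.+1) k.+1.
  by rewrite /rest_num sAprod; apply: eq_bigr => j _; exact: substA_phi.
rewrite sAM sAw sAr !algM -[LHS]mulrA; congr (_ * _).
by rewrite algC mpoly_algC -mulrA -mpolyCM mulr_algr.
Qed.

Theorem regular_consecutive_value : (0 < n)%N -> v 0 = 1 ->
  (forall k, (k < n)%N -> regular_step k) ->
  consecutive_value (fusion_Phi n q t s n) c (v n).
Proof.
move=> n0 v0 reg; exists (fun k => if k == 0%N then fusion_Phi n q t s n else stage k).
split=> // [[k kn] /=|]; last first.
  rewrite (gtn_eqF n0) /rf_eq /= /rest_num /rest_den /index_iota subnn !big_nil.
  by rewrite mul1r.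
case: eqVneq => [k0|_]; last exact: (stage_value kn (f := stage k) (reg _ kn) erefl erefl).
subst k; have [PhiN PhiD] := fusion_PhiE (leqnn n).
have [rn rd] : rest_num (zvar n K) 0 = rest_num (zeta 0) 0 /\
    rest_den (zvar n K) 0 = rest_den (zeta 0) 0.
  by apply: eq_rest => i /andP[i0 _]; rewrite /zeta leqNgt i0.
apply: (stage_value kn (reg _ kn)); rewrite ?PhiN ?PhiD; last by rewrite -rd.
by rewrite v0 mpolyC1 mulr1 -rn.
Qed.

End ConsecutiveEvaluation.

(** * The fusion formula *)

Section TableauStacks.
Variables (m n : nat) (la : m.-tuple intpart) (T : node m -> nat) (x0 : node m).
Hypothesis T_tableau : is_tableau n la T.
Hypothesis T_standard : is_standard la T.
Local Open Scope nat_scope.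

Definition tableau_node i : node m := odflt x0 (node_at la T i).
Local Notation x := tableau_node.
Local Notation D := (stack_upto x).

Lemma tableau_nodeP i : 0 < i <= n ->
  [/\ node_at la T i = Some (x i), x i \in diagram la & T (x i) = i].
Proof.
case: T_tableau => _ _ surj /surj[y yla Ty].
suff: exists2 z, node_at la T i = Some z & (z \in diagram la) /\ T z = i.
  by case=> z E [zla Tz]; rewrite /x E.
rewrite /node_at; have: y \in [seq y <- diagram la | T y == i] by rewrite mem_filter Ty eqxx.
case E: [seq _ <- _ | _] => [//|z l] _; exists z => //.
have: z \in [seq y <- diagram la | T y == i] by rewrite E mem_head.
by rewrite mem_filter => /andP[/eqP].
Qed.

Lemma mem_stack_upto k y : k <= n -> (y \in D k) = (y \in diagram la) && (T y <= k).
Proof.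
case: T_tableau => Tn Tinj _; elim: k => [_|k IH kn].
  by rewrite in_nil; apply/esym/negbTE/negP => /andP[/Tn/andP[]]; case: (T y).
have [|_ xla Tx] := @tableau_nodeP k.+1; first by [].
rewrite stack_uptoS inE IH ?(ltnW kn) // [T y <= k.+1]leq_eqVlt ltnS.
have [->|yx] := eqVneq y (x k.+1); first by rewrite xla Tx eqxx.
case yla: (y \in diagram la) => //=.
by case: eqVneq => //= Ty; case/eqP: yx; apply: Tinj; rewrite ?Tx.
Qed.

Lemma stacked_tableau k : k <= n -> stacked (D k).
Proof.
elim: k => // k IH kn; rewrite stack_uptoS /= IH ?(ltnW kn) // andbT.
have [|_ xla Tx] := @tableau_nodeP k.+1; first by [].
case E: (x k.+1) xla Tx => [[a b] c] abc Tabc.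
have := abc; rewrite mem_diagram => /and3P[a0 b0 ab].
rewrite /= a0 b0 !mem_stack_upto ?(ltnW kn) // abc Tabc ltnn /=.
have [rows cols] := T_standard; apply/andP; split.
  case: eqVneq => //= a1.
  have u : (a.-1, b, c) \in diagram la.
    rewrite mem_diagram b0 (leq_trans ab) ?part_row_le ?andbT; lia.
  by rewrite u -ltnS -Tabc; apply: cols; rewrite ?prednK.
case: eqVneq => //= b1.
have l : (a, b.-1, c) \in diagram la by rewrite mem_diagram; lia.
by rewrite l -ltnS -Tabc; apply: rows; rewrite ?prednK.
Qed.

Lemma subdiagram_stack k : k <= n ->
  addable_nodes (subdiagram la T k) = addable_nodes (D k).
Proof.
move=> kn; have kD : subdiagram la T k =i D k.
  by move=> y; rewrite mem_filter mem_stack_upto // andbC.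
apply: eq_addable_nodes => //; apply: perm_size; apply: uniq_perm => //.
  by rewrite filter_uniq // diagram_uniq.
exact/stacked_uniq/stacked_tableau.
Qed.

Lemma stack_tableau_diagram : D n =i diagram la.
Proof.
move=> y; rewrite mem_stack_upto //; case: T_tableau => Tn _ _.
by apply: andb_idr => /Tn/andP[].
Qed.

Lemma residue_at_tableau (K : fieldType) (q : 'I_m -> K) i : 0 < i <= n ->
  residue_at q la T i = residue q (x i).
Proof. by move=> /tableau_nodeP[E _ _]; rewrite /residue_at E. Qed.

Lemma young_idempotentE (K : fieldType) (q : 'I_m -> K) (A : algType K) (t : A) s k : k <= n ->
  young_idempotent q la T t s k = stack_idempotent q t s (D k).
Proof.
elim: k => // k IH kn; rewrite [LHS]/= IH ?(ltnW kn) // subdiagram_stack ?(ltnW kn) //.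
have kn' : 0 < k.+1 <= n by [].
have [E _ _] := tableau_nodeP kn'; rewrite E residue_at_tableau //.
rewrite stack_uptoS stack_idempotent_cons size_stack_upto; congr (_ * _)%R.
rewrite scaler_prod prodfV; congr (_^-1 *: _)%R.
  by rewrite horner_prod; apply: eq_bigr => y _; rewrite hornerXsubC.
rewrite rmorph_prod; apply: eq_bigr => y _.
by rewrite rmorphB /= horner_algX horner_algC.
Qed.

End TableauStacks.

Section Fusion.
Variables (K : fieldType) (m n : nat) (q : 'I_m -> K).
Variables (A : algType K) (t : A) (s : nat -> A).
Hypothesis rel : forall x y, hecke_rel n q t s x y -> x = y.
Hypothesis gen : generic n q.
Variable x : nat -> node m.
Hypothesis sx : stacked (stack_upto x n).

Local Notation res := (residue q).
Local Notation D := (stack_upto x).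

Lemma phi_den_nat k : phi_den q x k = \prod_(1 <= i < k.+1) ('X - (res (x i))%:P).
Proof.
elim: k => [|k IH]; first by rewrite /phi_den big_nil big_geq.
by rewrite big_nat_recr // -IH /phi_den big_cons mulrC.
Qed.

(** The factors z - res x, P' and the strips are those of [phi_poly_regular], and the change
    of the hook product accounts for the value of the strips. *)
Lemma fusion_regular_step (c : nat -> K) k : (k < n)%N ->
  (forall i, (0 < i <= n)%N -> c i = res (x i)) ->
  regular_step q t s c (fun k => hook_prod q (D k) *: stack_idempotent q t s (D k)) k.
Proof.
move=> kn cE; have sk : stacked (D k.+1) by apply: (stacked_upto sx).
have [cx sD] := andP sk; set y := x k.+1 in cx.
have szD : size (D k) = k by exact: size_stack_upto.
pose w c : {poly K} := (q c)%:P.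
pose N := strip_num w 'X (D k) y; pose Da := strip_den w 'X (D k) y.
have nv z : node_value w z = (res z)%:P.
  by rewrite residue_node_value /node_value polyCD polyCB !polyC_natr.
have NDa : ('X - (res y)%:P) * N * phi_den q x k ^+ 2 = Da * phi_factor q x k.
  have := strip_num_den w 'X sD cx; rewrite nv => E.
  rewrite /phi_den /phi_factor -prodrXl; under eq_bigr do rewrite -nv.
  by rewrite E; congr (_ * (_ * _)); apply: eq_bigr => z _; rewrite nv.
have [S key Sc] := phi_poly_regular rel gen sx kn NDa.
set P' := addable_poly_but q (D k) (x k.+1) in key Sc.
have evX : horner_eval (res y) 'X = res y by rewrite /horner_eval hornerX.
have evw : horner_eval (res y) \o w = q.
  by apply/funext => c'; rewrite /= /horner_eval hornerC.
have evN : N.[res y] = strip_num q (res y) (D k) y.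
  by rewrite -[LHS]/(horner_eval (res y) N) rmorph_strip_num /= evw evX.
have evD : Da.[res y] = strip_den q (res y) (D k) y.
  by rewrite -[LHS]/(horner_eval (res y) Da) rmorph_strip_den /= evw evX.
clearbody N Da; pose h := hook_prod q (D k); set e := stack_idempotent q t s (D k) in key *.
exists (P' * Da), (central_poly A (h%:P * N) * (e%:P * S)).
have cy : c k.+1 = res y by apply: cE.
have P'0 : P'.[res y] != 0 by apply: (addable_poly_but_neq0 gen sD cx); rewrite szD.
have cP p (P : {poly A}) : central_poly A p * P = P * central_poly A p.
  by rewrite (central_polyP p P).
rewrite cy; split.
- rewrite (eq_phi_num _ _ (w' := fun i => (res (x i))%:A%:P)); last first.
    by move=> i /andP[i0 ik]; rewrite cE // i0; lia.
  have -> : \prod_(1 <= i < k.+1) ('X - (c i)%:P) = phi_den q x k.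
    by rewrite phi_den_nat; apply: eq_big_nat => i /andP[i0 ik]; rewrite cE // i0; lia.
  have -> : (h *: e)%:P = central_poly A h%:P * e%:P.
    by rewrite central_polyC -polyCM mulr_algl.
  have CM a b : central_poly A (a * b) = central_poly A a * central_poly A b by exact: rmorphM.
  rewrite -/(phi_poly q t s x k.+1).
  transitivity (central_poly A h%:P * (phi_poly q t s x k.+1 * e%:P * central_poly A (P' * Da))).
    by rewrite !mulrA (cP h%:P (phi_poly _ _ _ _ _)).
  rewrite key !mulrA -!CM.
  by congr (central_poly A _ * _ * _); ring.
- rewrite hornerM mulf_neq0 // evD; apply: (strip_den_neq0 gen sD) => //.
  by rewrite szD ltnW.
rewrite horner_algM horner_central horner_algM hornerC Sc !hornerM hornerC evN evD.
rewrite stack_uptoS stack_idempotent_cons szD -/e -/y -/P' mulr_algl -scalerAr !scalerA.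
have -> : h * strip_num q (res y) (D k) y = hook_prod q (D k.+1) * strip_den q (res y) (D k) y.
  by rewrite /h residue_node_value hook_prod_cons.
by congr (_ *: _); field.
Qed.

End Fusion.

Theorem theorem4p10 (K : fieldType) (m n : nat)
    (m_gt0 : (0 < m)%N) (n_gt0 : (0 < n)%N) (q : 'I_m -> K)
    (q_generic : generic_value n q != 0)
    (la : m.-tuple intpart) (la_size : multipart_size la = n)
    (T : node m -> nat) (T_tableau : is_tableau n la T)
    (T_standard : is_standard la T) :
  let t := hecke_t n q m_gt0 in
  let s := hecke_s n q m_gt0 in
  exists2 v : hecke n q m_gt0,
    consecutive_value (fusion_Phi n q t s n) (residue_at q la T) v
    & young_idempotent q la T t s n = Theta q la *: v.
Proof.
move=> t s; have gen := generic_valueP q_generic.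
have rel : forall x y, hecke_rel n q t s x y -> x = y := @hecke_relations K m n q m_gt0.
pose x0 : node m := (0%N, 0%N, Ordinal m_gt0); pose x := tableau_node la T x0.
have sx : stacked (stack_upto x n) by apply: (stacked_tableau _ T_tableau T_standard).
exists (hook_prod q (stack_upto x n) *: stack_idempotent q t s (stack_upto x n)); last first.
  rewrite (young_idempotentE x0 T_tableau T_standard) //.
  rewrite (Theta_hook_prod q sx (stack_tableau_diagram x0 T_tableau)).
  by rewrite scalerA mulVf ?scale1r // (hook_prod_neq0 gen) // size_stack_upto.
apply: (regular_consecutive_value (v := fun k => hook_prod q (stack_upto x k) *:
    stack_idempotent q t s (stack_upto x k))) => //.
  by rewrite /= /hook_prod big_nil scale1r.
move=> k kn; apply: (fusion_regular_step rel gen sx kn) => i iN.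
exact: (residue_at_tableau x0 T_tableau).
Qed.
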